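(* Let $X$ and $Y$ be represented spaces. Then the following are computable isomorphisms: (1) $\mathrm{id}:(X\times Y)'\to X'\times Y'$; (2) $\mathrm{id}:(X^{\mathbb{N}})'\to(X')^{\mathbb{N}}$; (3) $\mathrm{id}:\mathcal{C}(X,Y)'\to\mathcal{C}(X',Y')$. In particular, $\mathcal{C}(X',Y')$ is exactly the set of continuous functions $f:X\to Y$.
   Context: A representation of a set $X$ is a surjective partial function $\delta_X:\subseteq\mathbb{N}^{\mathbb{N}}\to X$; $(X,\delta_X)$ is then a represented space. $F:\subseteq\mathbb{N}^{\mathbb{N}}\to\mathbb{N}^{\mathbb{N}}$ is a realizer of $f:X\to Y$, written $F\vdash f$, if $\delta_YF(p)=f\delta_X(p)$ for all $p\in\mathrm{dom}(\delta_X)$. A function between represented spaces is continuous (computable) if it has a continuous (computable) realizer. $\mathcal{C}(X,Y)$ is the set of total continuous functions $f:X\to Y$ in this sense. A function $f:X\to Y$ is a computable isomorphism if it is bijective and both $f$ and $f^{-1}$ are computable. A partial function $F:\subseteq\mathbb{N}^{\mathbb{N}}\to\mathbb{N}^{\mathbb{N}}$ is computable if there is a Turing machine (infinite input tape, one-way output tape) that on each $p\in\mathrm{dom}(F)$ produces $F(p)$ in the long run; nothing is required outside $\mathrm{dom}(F)$. Coding: $\langle n,k\rangle:=\frac12(n+k)(n+k+1)+k$; $\langle p,q\rangle(2n):=p(n)$, $\langle p,q\rangle(2n+1):=q(n)$; $\langle p_0,p_1,\dots\rangle\langle n,k\rangle:=p_n(k)$. Let $\lim:\subseteq\mathbb{N}^{\mathbb{N}}\to\mathbb{N}^{\mathbb{N}}$,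 $\langle p_0,p_1,\dots\rangle\mapsto\lim_{i\to\infty}p_i$ (product topology). For a represented space $(X,\delta_X)$, $X'$ is the set $X$ with representation $\delta_X\circ\lim$. $q\mapsto\Phi_q$ (defined for all $q\in\mathbb{N}^{\mathbb{N}}$) is a standard representation of the continuous partial functions $\subseteq\mathbb{N}^{\mathbb{N}}\to\mathbb{N}^{\mathbb{N}}$ with $G_\delta$-domain (every continuous partial function on $\mathbb{N}^{\mathbb{N}}$ has an extension $\Phi_q$), satisfying the utm-theorem ($\langle q,p\rangle\mapsto\Phi_q(p)$ is computable) and the smn-theorem (for every computable $F:\subseteq\mathbb{N}^{\mathbb{N}}\to\mathbb{N}^{\mathbb{N}}$ there is a total computable $S:\mathbb{N}^{\mathbb{N}}\to\mathbb{N}^{\mathbb{N}}$ with $\Phi_{S(q)}(p)=F\langle q,p\rangle$ for all $\langle q,p\rangle\in\mathrm{dom}(F)$). Representations: $\delta_{X\times Y}\langle p,q\rangle:=(\delta_X(p),\delta_Y(q))$; $\delta_{X^{\mathbb{N}}}\langle p_0,p_1,\dots\rangle:=(\delta_X(p_n))_{n\in\mathbb{N}}$; $\delta_{\mathcal{C}(X,Y)}(p)=f:\iff\Phi_p\vdash f$. *)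

(* Defs.v *)
From HB Require Import structures.
From mathcomp Require Import all_boot.
From mathcomp Require Import all_classical topology borel_hierarchy.

Set Implicit Arguments.
Unset Strict Implicit.
Unset Printing Implicit Defensive.

Local Open Scope classical_set_scope.
Local Open Scope nat_scope.

(* Partial functions are single-valued graphs: [F a b] reads "a is in dom F
   and F(a) = b". *)
Record pfun (A B : Type) := PFun {
  graph :> A -> B -> Prop;
  graph_fun : forall a b b', graph a b -> graph a b' -> b = b' }.

Section PartialFunctions.
Context {A B C : Type}.

Definition pdom (F : pfun A B) : set A := [set a | exists b, F a b].

Definition ppreim (F : pfun A B) (V : set B) : set A :=
  [set a | exists2 b, F a b & V b].

Program Definition total (f : A -> B) : pfun A B := @PFun A B (fun a b => b = f a) _.
Next Obligation. by move=> f a b b' -> ->. Qed.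

Program Definition pcomp (G : pfun B C) (F : pfun A B) : pfun A C :=
  @PFun A C (fun a c => exists2 b, F a b & G b c) _.
Next Obligation.
by move=> G F a c c' [b Fb Gc] [b' /(graph_fun Fb) <-]; exact: graph_fun.
Qed.

End PartialFunctions.

(* Baire space, with the product of the discrete topologies. *)
Definition baire : Type := prod_topology (fun _ : nat => nat).
HB.instance Definition _ := Topological.on baire.

Lemma baire_hausdorff : hausdorff_space baire.
Proof. by apply: hausdorff_product => ?; exact: discrete_hausdorff. Qed.

(* Continuity with respect to the subspace topology of the domain. *)
Definition pcontinuous (F : pfun baire baire) : Prop :=
  forall V : set baire, open V ->
    exists2 U : set baire, open U & ppreim F V = U `&` pdom F.

(* Both pairings <p,q> and <p_0,p_1,...> are bijections onto Baire space; they
   are represented by their projections: r = <bleft r, bright r> and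
   r = <row r 0, row r 1, ...>. *)
Definition bleft (r : baire) : baire := fun n => r n.*2.
Definition bright (r : baire) : baire := fun n => r n.*2.+1.

Definition bpair (p q : baire) : baire :=
  fun m => if odd m then q m./2 else p m./2.

Lemma bpairKl p q : bleft (bpair p q) = p.
Proof. by apply/funext => n; rewrite /bleft /bpair odd_double doubleK. Qed.

Lemma bpairKr p q : bright (bpair p q) = q.
Proof.
by apply/funext => n; rewrite /bright /bpair /= odd_double uphalf_double.
Qed.

Definition cpair (n k : nat) : nat := ((n + k) * (n + k).+1)./2 + k.

Definition row (r : baire) (n : nat) : baire := fun k => r (cpair n k).

Lemma cpair_inj n k n' k' : cpair n k = cpair n' k' -> n = n' /\ k = k'.
Proof.
have T s : (s.+1 * s.+2)./2 = (s * s.+1)./2 + s.+1.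
  rewrite (_ : s.+1 * s.+2 = s.+1.*2 + s * s.+1).
    by rewrite halfD odd_double doubleK add0n addnC.
  by rewrite mulnC -addn2 mulnDl mul2n addnC.
have Tmono : {homo (fun s => (s * s.+1)./2) : s t / s <= t}.
  by move=> s t le_st; apply: half_leq; rewrite leq_mul.
have lt m a b m' a' b' : m = a + b -> m' = a' + b' -> m < m' ->
    (m * m.+1)./2 + b < (m' * m'.+1)./2 + b'.
  move=> -> -> lt_m; apply: leq_trans (leq_addr _ _).
  apply: leq_trans (Tmono _ _ lt_m); rewrite T.
  by rewrite ltn_add2l ltnS leq_addl.
rewrite /cpair => eq_nk.
case: (ltngtP (n + k) (n' + k')) => [/lt|/lt|eqs].
- by move=> /(_ _ _ _ _ erefl erefl); rewrite eq_nk ltnn.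
- by move=> /(_ _ _ _ _ erefl erefl); rewrite eq_nk ltnn.
- move: eq_nk; rewrite eqs => /addnI eqk; split => //.
  by move: eqs; rewrite eqk => /addIn.
Qed.

Lemma rows_surj (ps : nat -> baire) : exists r, forall n, row r n = ps n.
Proof.
have /choice[r rE] m : exists v, forall n k, cpair n k = m -> v = ps n k.
  have [[n [k <-]]|nP] := pselect (exists n k, cpair n k = m).
    by exists (ps n k) => n' k' /cpair_inj [-> ->].
  by exists 0 => n k mE; case: nP; exists n, k.
by exists r => n; apply/funext => k; exact: rE.
Qed.

(* Type-2 Turing machines: a two-way read-only input tape holding an infinite
   binary word, a write-only one-way binary output tape, and finitely many
   one-way infinite work tapes.  A machine that stops is one that loops
   without writing. *)
Variant move := MoveL | Stay | MoveR.

Definition apply_move (m : move) (i : nat) : nat :=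
  match m with MoveL => i.-1 | Stay => i | MoveR => i.+1 end.

Record action (state symb : Type) (k : nat) := Action {
  new_state : state;
  input_move : move;
  work_write : 'I_k -> symb;
  work_move : 'I_k -> move;
  output : option bool }.

Record machine := Machine {
  state : finType;
  symb : finType;
  ntapes : nat;
  start : state;
  blank : symb;
  delta : state -> bool -> {ffun 'I_ntapes -> symb} ->
          action state symb ntapes }.

Record config (M : machine) := Config {
  cstate : state M;
  input_head : nat;
  tape : 'I_(ntapes M) -> nat -> symb M;
  work_head : 'I_(ntapes M) -> nat;
  written : seq bool }.

Definition init (M : machine) : config M :=
  Config (start M) 0 (fun _ _ => blank M) (fun _ => 0) [::].

Definition step (M : machine) (w : nat -> bool) (c : config M) : config M :=
  let a := delta (cstate c) (w (input_head c))
                 [ffun i => tape c i (work_head c i)] in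
  Config (new_state a)
    (apply_move (input_move a) (input_head c))
    (fun i j => if j == work_head c i then work_write a i else tape c i j)
    (fun i => apply_move (work_move a i) (work_head c i))
    (written c ++ seq_of_opt (output a)).

(* Sequences of numbers are written on the tapes in unary, each number being
   terminated by [false]; [code p n] is the code of p(0), ..., p(n-1). *)
Definition code (p : baire) (n : nat) : seq bool :=
  flatten [seq rcons (nseq (p i) true) false | i <- iota 0 n].

Definition code_word (p : baire) (j : nat) : bool := nth false (code p j.+1) j.

Definition produces (M : machine) (p q : baire) : Prop :=
  forall n, exists t,
    prefix (code q n) (written (iter t (step (code_word p)) (init M))).

Definition pcomputable (F : pfun baire baire) : Prop :=
  exists M : machine, forall p q, F p q -> produces M p q.

Program Definition lim_baire : pfun baire baire :=
  @PFun baire baire (fun r q => row r n @[n --> \oo] --> q) _.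
Next Obligation.
by move=> r q q'; apply: cvg_unique => //; exact: baire_hausdorff.
Qed.

Record rspace := RSpace {
  pt :> Type;
  rep : pfun baire pt;
  rep_surj : forall x, exists p, rep p x }.

Section Maps.
Context {X Y : rspace}.
Implicit Types (F : pfun baire baire) (f : X -> Y).

Definition realizes F f : Prop :=
  forall p x, rep X p x -> exists2 q, F p q & rep Y q (f x).

Definition rcontinuous f : Prop := exists2 F, pcontinuous F & realizes F f.

Definition rcomputable f : Prop := exists2 F, pcomputable F & realizes F f.

End Maps.

Definition computable_iso {X Y : rspace} (f : X -> Y) : Prop :=
  rcomputable f /\
  exists g : Y -> X, [/\ cancel f g, cancel g f & rcomputable g].

Program Definition jump (X : rspace) : rspace :=
  @RSpace X (pcomp (rep X) lim_baire) _.
Next Obligation.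
move=> X x; have [p px] := rep_surj x; have [r rE] := rows_surj (fun=> p).
exists r, p => //=; rewrite (_ : row r = fun=> p); last exact/funext.
exact: cvg_cst.
Qed.

Program Definition prod_space (X Y : rspace) : rspace :=
  @RSpace (X * Y) (@PFun baire (X * Y)
    (fun r z => rep X (bleft r) z.1 /\ rep Y (bright r) z.2) _) _.
Next Obligation.
move=> X Y r [x y] [x' y'] /= [rx ry] [/(graph_fun rx) <- /(graph_fun ry) <-].
by [].
Qed.
Next Obligation.
move=> X Y [x y]; have [p px] := rep_surj x; have [q qy] := rep_surj y.
by exists (bpair p q); rewrite /= bpairKl bpairKr.
Qed.

Program Definition seq_space (X : rspace) : rspace :=
  @RSpace (nat -> X) (@PFun baire (nat -> X)
    (fun r s => forall n, rep X (row r n) (s n)) _) _.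
Next Obligation.
by move=> X r s s' rs rs'; apply/funext => n; exact: graph_fun (rs n) (rs' n).
Qed.
Next Obligation.
move=> X s; have /choice[ps psE] n := rep_surj (s n).
by have [r rE] := rows_surj ps; exists r => n; rewrite rE.
Qed.

Program Definition uncurry_baire (Phi : baire -> pfun baire baire) :
    pfun baire baire :=
  @PFun baire baire (fun r s => Phi (bleft r) (bright r) s) _.
Next Obligation. by move=> Phi r s s'; exact: graph_fun. Qed.

(* No particular Phi is fixed: all those with the utm and smn properties are
   computably equivalent. *)
Record standard_rep := StandardRep {
  Phi :> baire -> pfun baire baire;
  Phi_cont : forall q, pcontinuous (Phi q) /\ Gdelta (pdom (Phi q));
  Phi_surj : forall F : pfun baire baire, pcontinuous F -> Gdelta (pdom F) ->
    exists q, forall p r, Phi q p r <-> F p r;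
  Phi_ext : forall F : pfun baire baire, pcontinuous F ->
    exists q, forall p r, F p r -> Phi q p r;
  Phi_utm : pcomputable (uncurry_baire Phi);
  Phi_smn : forall F : pfun baire baire, pcomputable F ->
    exists2 S : baire -> baire, pcomputable (total S) &
      forall q p r, F (bpair q p) r -> Phi (S q) p r }.

(* The carrier is the set of continuous functions; it is a type depending on
   the representations, so the identity map between two such spaces is a map
   commuting with [sval]. *)
Program Definition cont_space (P : standard_rep) (X Y : rspace) : rspace :=
  @RSpace {f : X -> Y | rcontinuous f}
    (@PFun baire {f : X -> Y | rcontinuous f}
      (fun p f => realizes (P p) (sval f)) _) _.
Next Obligation.
move=> P X Y p [f cf] [g cg] /= pf pg; apply: eq_exist; apply/funext => x.
have [r rx] := rep_surj x; have [q Pq qy] := pf _ _ rx.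
have [q' Pq' qy'] := pg _ _ rx; move: qy'.
by rewrite -(graph_fun Pq Pq'); exact: graph_fun.
Qed.
Next Obligation.
move=> P X Y [f [F cF Ff]] /=; have [q qF] := Phi_ext P cF.
by exists q => p x /Ff[r Fr ry]; exists r => //; exact: qF.
Qed.

(* Main.v *)
Require Import Defs.
From mathcomp Require Import all_boot zify.
From mathcomp Require Import all_classical topology.

(* The isomorphisms (1) and (2) permute the entries of a name.

   For (3), let [M] compute <q,u> |-> Phi_q(u).  If [r] converges to [p] and
   [r'] to [p'], the outputs of [M] after [n] steps on the [n]-th rows of [r]
   and [r'] converge to Phi_p(p'); the smn property turns this into a map on
   names.

   Conversely, let Phi_q realize f on jumps and let [p] be a name of [x].  A
   condition prescribes finitely many entries of a sequence [u] of sequences,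
   and that from then on finitely many columns of [u] agree with [p].  For
   each [k], some extension of any condition forces the entry [k] of the rows
   of Phi_q(u) to be constant from some row on: otherwise one could build a
   sequence [u] converging to [p] such that this entry changes infinitely often,
   although Phi_q(u) converges.  A search for such extensions, for k = 0, 1, ...,
   reads [p] continuously and yields the limit of Phi_q(u) for some [u]
   converging to [p], i.e. a name of f(x).  That a condition forces a value is
   a Pi_1 property relative to [q], hence an oracle for it is the limit of a
   sequence computable from [q]. *)

Set Implicit Arguments.
Unset Strict Implicit.
Unset Printing Implicit Defensive.

Local Open Scope classical_set_scope.
Local Open Scope nat_scope.

(** * Register machines on type-2 Turing machines *)

Variant op := Inc of nat | Dec of nat | Out of bool | InL | InR.

Variant instr := IOp of op | IJz of nat & nat | IJb of nat | IJmp of nat.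

Record rstate := St { regs : nat -> nat; ipos : nat; outp : seq bool }.

Definition set_reg s r v :=
  St (fun i => if i == r then v else regs s i) (ipos s) (outp s).

Definition exec_op o s :=
  match o with
  | Inc r => set_reg s r (regs s r).+1
  | Dec r => set_reg s r (regs s r).-1
  | Out b => St (regs s) (ipos s) (outp s ++ [:: b])
  | InL => St (regs s) (ipos s).-1 (outp s)
  | InR => St (regs s) (ipos s).+1 (outp s)
  end.

Lemma rstate_ext s s' :
  regs s =1 regs s' -> ipos s = ipos s' -> outp s = outp s' -> s = s'.
Proof. by case: s s' => [? ? ?] [? ? ?] /= /funext -> -> ->. Qed.

(** The default [IJmp x.1] makes a counter outside [C] loop in place, in accordance with the
    convention that stopping is looping without output. *)
Definition fstep (w : nat -> bool) (C : seq instr) (x : nat * rstate) :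
    nat * rstate :=
  match nth (IJmp x.1) C x.1 with
  | IOp o => (x.1.+1, exec_op o x.2)
  | IJz r l => (if regs x.2 r == 0 then l else x.1.+1, x.2)
  | IJb l => (if w (ipos x.2) then x.1.+1 else l, x.2)
  | IJmp l => (l, x.2)
  end.

Definition ibound i :=
  match i with
  | IOp (Inc r) | IOp (Dec r) => r.+1
  | IOp _ => 0
  | IJz r l => maxn r.+1 l
  | IJb l | IJmp l => l
  end.

(** A common bound for addresses and register indices: the same number sizes the control states and
    the family of work tapes. *)
Definition cbound (C : seq instr) := maxn (size C) (\max_(i <- C) ibound i).

Lemma ibound_nth C pc : pc < size C ->
  ibound (nth (IJmp pc) C pc) <= cbound C.
Proof.
move=> ltpc; rewrite /cbound leq_max; apply/orP; right.
move: (IJmp pc) => d; elim: C pc ltpc => // i C IHC [|n] /= ltn;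
  rewrite big_cons leq_max ?leqnn //.
by rewrite IHC ?orbT.
Qed.

Section RegisterMachine.
Variable C : seq instr.
Let B := cbound C.

Definition goto (pc : nat) : option 'I_B.+1 := Some (inord pc).

Definition move_at r m : 'I_B -> move :=
  fun i => if i == r :> nat then m else Stay.

(* A register is a work tape carrying the mark [true] in cell 0 only; the
   position of the head is the value of the register.  The extra state [None]
   is used to write the marks. *)
Definition rdelta (q : option 'I_B.+1) (b : bool) (a : {ffun 'I_B -> bool}) :
    action (option 'I_B.+1) bool B :=
  if q is Some pc then
    match nth (IJmp pc) C pc with
    | IOp (Inc r) => Action (goto pc.+1) Stay a (move_at r MoveR) None
    | IOp (Dec r) => Action (goto pc.+1) Stay a (move_at r MoveL) None
    | IOp (Out o) => Action (goto pc.+1) Stay a (fun=> Stay) (Some o)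
    | IOp InL => Action (goto pc.+1) MoveL a (fun=> Stay) None
    | IOp InR => Action (goto pc.+1) MoveR a (fun=> Stay) None
    | IJz r l =>
        Action (goto (if [exists i : 'I_B, (i == r :> nat) && a i] then l
                      else pc.+1)) Stay a (fun=> Stay) None
    | IJb l => Action (goto (if b then pc.+1 else l)) Stay a (fun=> Stay) None
    | IJmp l => Action (goto l) Stay a (fun=> Stay) None
    end
  else Action (goto 0) Stay (fun=> true) (fun=> Stay) None.

Definition rmachine := Machine None false rdelta.

Definition simulates (c : config rmachine) (x : nat * rstate) :=
  [/\ exists2 pc : 'I_B.+1, cstate c = Some pc & pc = x.1 :> nat,
      input_head c = ipos x.2, written c = outp x.2,
      forall i, work_head c i = regs x.2 i
    & forall i j, tape c i j = (j == 0)].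

Lemma val_goto pc x : pc <= B -> x = goto pc ->
  exists2 pc' : 'I_B.+1, x = Some pc' & pc' = pc :> nat.
Proof. by move=> lepc ->; exists (inord pc); rewrite ?inordK. Qed.

Lemma simulates_step w c x : simulates c x ->
  simulates (step w c) (fstep w C x).
Proof.
case: c => q h tp wh wr; case: x => pc0 s [[pc /= -> <-] -> -> whE tpE].
have [ltpc|lepc] := ltnP pc (size C); last first.
  rewrite /step /fstep /= nth_default //=; split => //=.
  - by exists (inord pc) => //; rewrite inordK.
  - by rewrite cats0.
  - by move=> i j; rewrite ffunE; case: eqP => [->|].
have pcB : pc < B by rewrite (leq_trans ltpc) // leq_maxl.
have lenth := ibound_nth ltpc; rewrite -/B in lenth.
(* The head of a tape scans the mark exactly in cell 0, so reading the mark is the zero test. *)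
have wrE r : r < B -> [exists i : 'I_B, (i == r :> nat) &&
    [ffun i => tp i (wh i)] i] = (regs s r == 0).
  move=> ltr; apply/existsP/eqP => [[i /andP[/eqP <-]]|r0].
    by rewrite ffunE tpE whE => /eqP.
  by exists (Ordinal ltr); rewrite eqxx ffunE tpE whE r0.
have wrtE (i : 'I_B) j : (if j == wh i then [ffun i => tp i (wh i)] i else tp i j)
   = (j == 0).
  by rewrite ffunE !tpE; case: eqP => [->|].
rewrite /step /fstep /=; move: lenth.
case: (nth _ C pc) => [[r|r|o||]|r l|l|l] /= le;
  split => //=; rewrite ?cats0 //; try by [apply: val_goto; first lia].
all: try by move=> i j; exact: wrtE.
- by move=> i; rewrite /move_at; case: eqP => [<-|]; rewrite -whE.
- by move=> i; rewrite /move_at; case: eqP => [<-|]; rewrite -whE.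
- rewrite wrE; last by lia.
  by case: eqP => _; apply: val_goto => //; lia.
- by case: (w _); apply: val_goto => //; lia.
Qed.

Definition start_rstate := St (fun=> 0) 0 [::].

(** The machine is one step behind the program, because its first step, from the state [None],
    writes the marks. *)
Lemma simulates_iter w n :
  simulates (iter n.+1 (step w) (init rmachine)) (iter n (fstep w C) (0, start_rstate)).
Proof.
elim: n => [|n IHn]; last by rewrite iterS [iter n.+1 _ _]iterS; exact: simulates_step.
split => //=; first by exists (inord 0) => //; rewrite inordK.
by move=> i j; case: eqP.
Qed.

End RegisterMachine.

(** * Structured programs, their compilation to jumps, and total correctness *)

Inductive cmd :=
  | CSkip | COp of op | CSeq of cmd & cmd | CIf of nat & cmd & cmd
  | CWhile of nat & cmd | CWhileBit of cmd.

Inductive run (w : nat -> bool) : cmd -> rstate -> rstate -> Prop :=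
  | RunSkip s : run w CSkip s s
  | RunOp o s : run w (COp o) s (exec_op o s)
  | RunSeq c1 c2 s1 s2 s3 : run w c1 s1 s2 -> run w c2 s2 s3 ->
      run w (CSeq c1 c2) s1 s3
  | RunIfT r c1 c2 s s' : regs s r != 0 -> run w c1 s s' -> run w (CIf r c1 c2) s s'
  | RunIfF r c1 c2 s s' : regs s r = 0 -> run w c2 s s' -> run w (CIf r c1 c2) s s'
  | RunWhileF r c s : regs s r = 0 -> run w (CWhile r c) s s
  | RunWhileT r c s1 s2 s3 : regs s1 r != 0 -> run w c s1 s2 ->
      run w (CWhile r c) s2 s3 -> run w (CWhile r c) s1 s3
  | RunBitF c s : ~~ w (ipos s) -> run w (CWhileBit c) s s
  | RunBitT c s1 s2 s3 : w (ipos s1) -> run w c s1 s2 ->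
      run w (CWhileBit c) s2 s3 -> run w (CWhileBit c) s1 s3.

Fixpoint clen c :=
  match c with
  | CSkip => 0
  | COp _ => 1
  | CSeq c1 c2 => clen c1 + clen c2
  | CIf _ c1 c2 => (clen c1 + (clen c2).+1).+1
  | CWhile _ c | CWhileBit c => (clen c).+2
  end.

(** Jumps are absolute, hence the parameter [a], the address at which the block is placed. *)
Fixpoint flat a c : seq instr :=
  match c with
  | CSkip => [::]
  | COp o => [:: IOp o]
  | CSeq c1 c2 => flat a c1 ++ flat (a + clen c1) c2
  | CIf r c1 c2 => IJz r (a + clen c1 + 2) :: flat a.+1 c1 ++
      IJmp (a + clen c) :: flat (a + clen c1 + 2) c2
  | CWhile r c1 => IJz r (a + clen c) :: rcons (flat a.+1 c1) (IJmp a)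
  | CWhileBit c1 => IJb (a + clen c) :: rcons (flat a.+1 c1) (IJmp a)
  end.

Lemma size_flat a c : size (flat a c) = clen c.
Proof.
elim: c a => //= [c1 IH1 c2 IH2|r c1 IH1 c2 IH2|r c IHc|c IHc] a;
  by rewrite ?size_cat ?size_rcons /= ?IH1 ?IH2 ?IHc.
Qed.

Definition code_at (C : seq instr) a l := exists C1 C2, C = C1 ++ l ++ C2 /\ size C1 = a.

Lemma code_at_cat C a l1 l2 : code_at C a (l1 ++ l2) ->
  code_at C a l1 /\ code_at C (a + size l1) l2.
Proof.
move=> [C1 [C2 [-> <-]]]; split; first by exists C1, (l2 ++ C2); rewrite !catA.
by exists (C1 ++ l1), C2; rewrite size_cat !catA.
Qed.

Lemma code_at_cons C a i l : code_at C a (i :: l) ->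
  (forall x, nth x C a = i) /\ code_at C a.+1 l.
Proof.
rewrite -cat1s => /code_at_cat[[C1 [C2 [-> <-]]]]; rewrite addn1 => ?; split => // x.
by rewrite nth_cat ltnn subnn.
Qed.

Definition reach w C x y := exists n, iter n (fstep w C) x = y.

Lemma reach_refl w C x : reach w C x x. Proof. by exists 0. Qed.

Lemma reach_trans w C y x z : reach w C x y -> reach w C y z -> reach w C x z.
Proof. by move=> [n <-] [m <-]; exists (m + n); rewrite iterD. Qed.

Lemma reach_step w C x z : reach w C (fstep w C x) z -> reach w C x z.
Proof. by move=> [n <-]; exists n.+1; rewrite iterSr. Qed.

(** Induction on the run rather than on the command: each further round of a loop is a run of the
    same block at the same address. *)
Lemma reach_flat w C c s s' a : run w c s s' -> code_at C a (flat a c) ->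
  reach w C (a, s) (a + clen c, s').
Proof.
move=> r; elim: r a => {c s s'} /=.
- by move=> s a _; rewrite addn0; exact: reach_refl.
- move=> o s a /code_at_cons[Ca _]; apply: reach_step.
  by rewrite /fstep /= Ca addn1; exact: reach_refl.
- move=> c1 c2 s1 s2 s3 _ IH1 _ IH2 a /code_at_cat[/IH1 r1].
  by rewrite size_flat addnA => /IH2; exact: reach_trans.
- move=> r c1 c2 s s' nz _ IH a /code_at_cons[Ca /code_at_cat[/IH r1]].
  move=> /code_at_cons[Cb _]; apply: reach_step; rewrite /fstep /= Ca (negPf nz).
  apply: reach_trans r1 _; apply: reach_step; rewrite size_flat in Cb.
  by rewrite /fstep /= Cb /=; exact: reach_refl.
- move=> r c1 c2 s s' z _ IH a /code_at_cons[Ca /code_at_cat[_]].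
  move=> /code_at_cons[Cb C2]; apply: reach_step; rewrite /fstep /= Ca z eqxx.
  have -> : a + (clen c1 + (clen c2).+1).+1 = a + clen c1 + 2 + clen c2 by lia.
  apply: IH; move: C2; rewrite size_flat.
  by have -> : (a.+1 + clen c1).+1 = a + clen c1 + 2 by lia.
- move=> r c s z a /code_at_cons[Ca _]; apply: reach_step.
  by rewrite /fstep /= Ca z eqxx; exact: reach_refl.
- move=> r c s1 s2 s3 nz _ IH1 _ IH2 a Cw; apply: reach_trans (IH2 _ Cw).
  move: Cw => /code_at_cons[Ca]; rewrite -cats1 => /code_at_cat[/IH1 r1].
  move=> /code_at_cons[Cb _]; apply: reach_step; rewrite /fstep /= Ca (negPf nz).
  apply: reach_trans r1 _; apply: reach_step; rewrite size_flat in Cb.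
  by rewrite /fstep /= Cb /=; exact: reach_refl.
- move=> c s b a /code_at_cons[Ca _]; apply: reach_step.
  by rewrite /fstep /= Ca (negPf b); exact: reach_refl.
- move=> c s1 s2 s3 b _ IH1 _ IH2 a Cw; apply: reach_trans (IH2 _ Cw).
  move: Cw => /code_at_cons[Ca]; rewrite -cats1 => /code_at_cat[/IH1 r1].
  move=> /code_at_cons[Cb _]; apply: reach_step; rewrite /fstep /= Ca b.
  apply: reach_trans r1 _; apply: reach_step; rewrite size_flat in Cb.
  by rewrite /fstep /= Cb /=; exact: reach_refl.
Qed.

Definition wp w c (Q : rstate -> Prop) s := exists2 s', run w c s s' & Q s'.

Section WeakestPrecondition.
Variable w : nat -> bool.
Implicit Types (c : cmd) (Q : rstate -> Prop) (s : rstate) (r : nat).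

Lemma wp_weaken c Q Q' s : wp w c Q s -> (forall s', Q s' -> Q' s') -> wp w c Q' s.
Proof. by move=> [s' rs Qs] QQ'; exists s' => //; exact: QQ'. Qed.

Lemma wp_skip Q s : Q s -> wp w CSkip Q s.
Proof. by exists s => //; exact: RunSkip. Qed.

Lemma wp_op o Q s : Q (exec_op o s) -> wp w (COp o) Q s.
Proof. by exists (exec_op o s) => //; exact: RunOp. Qed.

Lemma wp_seq c1 c2 Q s : wp w c1 (wp w c2 Q) s -> wp w (CSeq c1 c2) Q s.
Proof. by move=> [s' r1 [s'' r2 Qs]]; exists s'' => //; exact: RunSeq r1 r2. Qed.

Lemma wp_if r c1 c2 Q s :
  (if regs s r == 0 then wp w c2 Q s else wp w c1 Q s) -> wp w (CIf r c1 c2) Q s.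
Proof.
case: eqP => [z|/eqP nz] [s' rs Qs]; exists s' => //; first exact: RunIfF.
exact: RunIfT.
Qed.

(** The invariant is indexed by the value of the tested register, and the body lowers the index by
    one; so termination comes with the invariant. *)
Lemma wp_while r c (I : nat -> rstate -> Prop) Q s n :
  (forall n s, I n s -> regs s r = n) ->
  (forall n s, I n.+1 s -> wp w c (I n) s) ->
  (forall s, I 0 s -> Q s) -> I n s -> wp w (CWhile r c) Q s.
Proof.
move=> Ir Ic IQ; elim: n s => [|n IHn] s Is.
  by exists s; [apply: RunWhileF; exact: Ir|exact: IQ].
have [s' rs /IHn[s'' rs' Qs]] := Ic _ _ Is.
by exists s'' => //; apply: RunWhileT rs rs'; rewrite (Ir _ _ Is).
Qed.

Lemma wp_whilebit c (I : nat -> rstate -> Prop) Q s n :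
  (forall n s, I n s -> w (ipos s) = (0 < n)) ->
  (forall n s, I n.+1 s -> wp w c (I n) s) ->
  (forall s, I 0 s -> Q s) -> I n s -> wp w (CWhileBit c) Q s.
Proof.
move=> Ir Ic IQ; elim: n s => [|n IHn] s Is.
  by exists s; [apply: RunBitF; rewrite (Ir _ _ Is)|exact: IQ].
have [s' rs /IHn[s'' rs' Qs]] := Ic _ _ Is.
by exists s'' => //; apply: RunBitT rs rs'; rewrite (Ir _ _ Is).
Qed.

End WeakestPrecondition.

(** * The inverse of the pairing function and the unary code of a sequence *)

Definition cunpair_step (x : nat * nat) : nat * nat :=
  if x.1 is n.+1 then (n, x.2.+1) else (x.2.+1, 0).

(** The steps run through the antidiagonals in the order of [cpair]; each one consists of
    increments, decrements and a transfer, as a register machine can do them. *)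
Definition cunpair m := iter m cunpair_step (0, 0).

Lemma tri_succ s : (s.+1 * s.+2)./2 = (s * s.+1)./2 + s.+1.
Proof.
rewrite (_ : s.+1 * s.+2 = s * s.+1 + s.+1.*2); last by lia.
by rewrite halfD odd_double andbF doubleK.
Qed.

Lemma cunpairK m : cpair (cunpair m).1 (cunpair m).2 = m.
Proof.
have E0 k : cpair k.+1 0 = (cpair 0 k).+1.
  by rewrite /cpair add0n !addn0 tri_succ addnS.
have ES n k : cpair n k.+1 = (cpair n.+1 k).+1.
  by rewrite /cpair addSnnS addnS.
rewrite /cunpair; elim: m => [|m] //; rewrite iterS.
by case: (iter m cunpair_step _) => [[|n] k] <-; [exact: E0|exact: ES].
Qed.

Lemma cpairK n k : cunpair (cpair n k) = (n, k).
Proof.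
by have := cunpairK (cpair n k); case: cunpair => a b /= /cpair_inj[-> ->].
Qed.

Lemma codeS (p : baire) i : code p i.+1 = code p i ++ rcons (nseq (p i) true) false.
Proof. by rewrite /code -addn1 iotaD map_cat flatten_cat /= cats0. Qed.

Lemma size_codeS (p : baire) i : size (code p i.+1) = size (code p i) + (p i).+1.
Proof. by rewrite codeS size_cat size_rcons size_nseq. Qed.

Lemma prefix_code (p : baire) i j : i <= j -> prefix (code p i) (code p j).
Proof.
elim: j => [|j IHj]; first by rewrite leqn0 => /eqP ->; exact: prefix_refl.
rewrite leq_eqVlt => /orP[/eqP ->|/IHj]; first exact: prefix_refl.
by move=> /prefix_trans; apply; rewrite codeS; exact: prefix_prefix.
Qed.

Lemma leq_size_code (p : baire) i : i <= size (code p i).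
Proof. by elim: i => // i IHi; rewrite size_codeS; lia. Qed.

Lemma code_wordE (p : baire) i r : r <= p i ->
  code_word p (size (code p i) + r) = (r < p i).
Proof.
move=> ler; rewrite /code_word; have := leq_size_code p i => lei.
have /prefixP[l ->] := @prefix_code p i.+1 (size (code p i) + r).+1 ltac:(lia).
rewrite codeS -catA nth_cat ltnNge leq_addr /= addKn nth_cat size_rcons size_nseq.
rewrite ltnS ler nth_rcons size_nseq; case: ltnP => [ltr|]; first by rewrite nth_nseq ltr.
by rewrite if_same.
Qed.

Ltac solve_rstate_eq :=
  apply: rstate_ext => //=; try lia;
  try (move=> ?; repeat (case: eqP => ? //=; subst => //=); try lia).

Ltac solve_regs := repeat (case: eqP => ? //=; subst => //=); try lia.

Local Notation "c1 ;; c2" := (CSeq c1 c2) (at level 60, right associativity).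

(** * Register programs for copying, pairing and reading the input *)

Section Macros.
Variable w : nat -> bool.
Implicit Types (Q : rstate -> Prop) (s : rstate).

Definition clear_reg r := CWhile r (COp (Dec r)).
Definition move_reg a b := CWhile a (COp (Dec a) ;; COp (Inc b)).
Definition dup_reg a b c :=
  CWhile a (COp (Dec a) ;; COp (Inc b) ;; COp (Inc c)).
(** Reading a register destroys it; the second copy in register 1 serves to restore [a]. *)
Definition copy_reg a b :=
  clear_reg b ;; clear_reg 1 ;; dup_reg a b 1 ;; move_reg 1 a.

Lemma wp_clear r Q s : Q (set_reg s r 0) -> wp w (clear_reg r) Q s.
Proof.
move=> Qs.
apply: (@wp_while _ _ _ (fun n s' => s' = set_reg s r n) Q s (regs s r)).
- by move=> n s' -> /=; rewrite eqxx.
- by move=> n s' ->; apply: wp_op => /=; rewrite eqxx; solve_rstate_eq.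
- by move=> s' ->.
- by solve_rstate_eq.
Qed.

Lemma wp_dup a b c Q s : a != b -> a != c -> b != c ->
  Q (set_reg (set_reg (set_reg s a 0) b (regs s b + regs s a)) c (regs s c + regs s a)) ->
  wp w (dup_reg a b c) Q s.
Proof.
move=> ab ac bc Qs.
apply: (@wp_while _ _ _ (fun n s' => n <= regs s a /\
  s' = set_reg (set_reg (set_reg s a n) b (regs s b + (regs s a - n))) c
            (regs s c + (regs s a - n))) Q s (regs s a)).
- by move=> n s' [_ ->] /=; rewrite (negPf ac) (negPf ab) eqxx.
- move=> n s' [len ->]; apply: wp_seq; apply: wp_op; apply: wp_seq; do 2!apply: wp_op.
  by split; [lia|solve_rstate_eq].
- by move=> s' [_ ->]; rewrite subn0.
- by split => //; solve_rstate_eq.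
Qed.

Lemma wp_move a b Q s : a != b ->
  Q (set_reg (set_reg s a 0) b (regs s b + regs s a)) -> wp w (move_reg a b) Q s.
Proof.
move=> ab Qs.
apply: (@wp_while _ _ _ (fun n s' => n <= regs s a /\
  s' = set_reg (set_reg s a n) b (regs s b + (regs s a - n))) Q s (regs s a)).
- by move=> n s' [_ ->] /=; rewrite (negPf ab) eqxx.
- by move=> n s' [len ->]; apply: wp_seq; do 2!apply: wp_op; split; [lia|solve_rstate_eq].
- by move=> s' [_ ->]; rewrite subn0.
- by split => //; solve_rstate_eq.
Qed.

Lemma wp_copy a b Q s : 1 < a -> 1 < b -> a != b ->
  Q (set_reg (set_reg s b (regs s a)) 1 0) -> wp w (copy_reg a b) Q s.
Proof.
move=> a1 b1 ab Qs; apply: wp_seq; apply: wp_clear; apply: wp_seq; apply: wp_clear.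
apply: wp_seq; apply: wp_dup => //; try lia; apply: wp_move; first lia.
by move: Qs; congr Q; solve_rstate_eq.
Qed.

(** Performs [cunpair_step] on the registers [d] and [d.+1]; the initial value of [d] is counted
    down in [d.+2]. *)
Definition prog_unpair d :=
  clear_reg d.+1 ;; clear_reg d.+2 ;; move_reg d d.+2 ;;
  CWhile d.+2 (COp (Dec d.+2) ;;
    CIf d (COp (Dec d) ;; COp (Inc d.+1)) (move_reg d.+1 d ;; COp (Inc d))).

Lemma wp_unpair d Q s :
  Q (set_reg (set_reg (set_reg s d (cunpair (regs s d)).1)
       d.+1 (cunpair (regs s d)).2) d.+2 0) ->
  wp w (prog_unpair d) Q s.
Proof.
move=> Qs; apply: wp_seq; apply: wp_clear; apply: wp_seq; apply: wp_clear.
apply: wp_seq; apply: wp_move; first lia.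
set m := regs s d in Qs *.
apply: (@wp_while _ _ _ (fun n s' => n <= m /\
  s' = set_reg (set_reg (set_reg s d (cunpair (m - n)).1)
         d.+1 (cunpair (m - n)).2) d.+2 n) _ _ m).
- by move=> n s' [_ ->] /=; rewrite eqxx.
- move=> n s' [len ->]; apply: wp_seq; apply: wp_op; apply: wp_if.
  have -> : cunpair (m - n) = cunpair_step (cunpair (m - n.+1)).
    by have -> : m - n = (m - n.+1).+1 by lia.
  case: (cunpair (m - n.+1)) => [n0 k] /=.
  have -> : (d == d.+2) = false by lia.
  have -> : (d == d.+1) = false by lia.
  rewrite eqxx.
  case: n0 => [|n0] /=; apply: wp_seq.
    by apply: wp_move; first lia; apply: wp_op; split; [lia|solve_rstate_eq].
  by do 2!apply: wp_op; split; [lia|solve_rstate_eq].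
- by move=> s' [_ ->]; rewrite subn0.
- by split => //; rewrite subnn /cunpair /= /m; solve_rstate_eq.
Qed.

(** With n and k in [d] and [d.+1], the loop adds s, s-1, ..., 1 for s = n + k to the copy of k in
    [d.+3], that is, the triangular number of s. *)
Definition prog_pair d :=
  clear_reg d.+2 ;; clear_reg d.+3 ;; dup_reg d.+1 d.+2 d.+3 ;;
  move_reg d d.+2 ;;
  CWhile d.+2 (dup_reg d.+2 d d.+3 ;; COp (Dec d) ;; move_reg d d.+2) ;;
  move_reg d.+3 d.

Lemma wp_pair d Q s :
  Q (set_reg (set_reg (set_reg (set_reg s d (cpair (regs s d) (regs s d.+1)))
       d.+1 0) d.+2 0) d.+3 0) ->
  wp w (prog_pair d) Q s.
Proof.
move=> Qs; set n := regs s d in Qs *; set k := regs s d.+1 in Qs *.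
apply: wp_seq; apply: wp_clear; apply: wp_seq; apply: wp_clear.
apply: wp_seq; apply: wp_dup; [lia..|]; apply: wp_seq; apply: wp_move; first lia.
apply: wp_seq.
apply: (@wp_while _ _ _ (fun m s' =>
  s' = set_reg (set_reg (set_reg (set_reg s d 0) d.+1 0) d.+2 m)
         d.+3 (cpair n k - (m * m.+1)./2) /\ m <= n + k) _ _ (n + k)).
- by move=> m s' [-> _] /=; solve_regs.
- move=> m s' [-> lem]; apply: wp_seq; apply: wp_dup; [lia..|].
  apply: wp_seq; apply: wp_op; apply: wp_move; first lia.
  split; last by lia.
  have T1 := tri_succ m.
  (* This keeps the truncated subtraction in the invariant exact. *)
  have T2 : (m.+1 * m.+2)./2 <= ((n + k) * (n + k).+1)./2.
    by apply: half_leq; apply: leq_mul.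
  by rewrite /cpair; solve_rstate_eq.
- move=> s' [-> _]; apply: wp_move; first lia.
  by move: Qs; congr Q; solve_rstate_eq.
- split => //; rewrite /cpair /n /k; solve_rstate_eq.
Qed.

Definition set_ipos s x := St (fun i => if i == 0 then x else regs s i) x (outp s).

(* The left end of the input tape is not marked, so register 0 mirrors the
   position of the input head. *)
Definition prog_orc d :=
  CWhile 0 (COp (Dec 0) ;; COp InL) ;;
  CWhile d (COp (Dec d) ;; CWhileBit (COp InR ;; COp (Inc 0)) ;;
            COp InR ;; COp (Inc 0)) ;;
  CWhileBit (COp InR ;; COp (Inc 0) ;; COp (Inc d)).

End Macros.

(** The head is rewound, then moved past as many blocks of the code as [d] says, and finally the
    marks of the next block are counted. The postcondition must hold for every final head position
    [x]. *)
Lemma wp_orc (p : baire) d (Q : rstate -> Prop) s : 1 < d -> regs s 0 = ipos s ->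
  (forall x, Q (set_ipos (set_reg s d (p (regs s d))) x)) ->
  wp (code_word p) (prog_orc d) Q s.
Proof.
move=> d1 s0 Qs; set n := regs s d in Qs *; apply: wp_seq.
apply: (@wp_while _ _ _ (fun m s' => s' = set_ipos s m) _ _ (ipos s)).
- by move=> m s' ->.
- by move=> m s' ->; apply: wp_seq; do 2!apply: wp_op; solve_rstate_eq.
- move=> _ ->; apply: wp_seq.
  apply: (@wp_while _ _ _ (fun m s' => m <= n /\
    s' = set_ipos (set_reg s d m) (size (code p (n - m)))) _ _ n).
  - by move=> m s' [_ ->] /=; solve_regs.
  - move=> m s' [len ->]; have -> : n - m = (n - m.+1).+1 by lia.
    move: (n - m.+1) => i; apply: wp_seq; apply: wp_op; apply: wp_seq.
    apply: (@wp_whilebit _ _ (fun j s' => j <= p i /\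
      s' = set_ipos (set_reg s d m) (size (code p i) + (p i - j))) _ _ (p i)).
    + by move=> j s1 [lej ->] /=; rewrite code_wordE; lia.
    + by move=> j s1 [lej ->]; apply: wp_seq; do 2!apply: wp_op;
        split; [lia|solve_rstate_eq].
    + move=> s1 [_ ->]; apply: wp_seq; do 2!apply: wp_op; split; first lia.
      by rewrite size_codeS; solve_rstate_eq.
    + by split => //; solve_rstate_eq.
  - move=> s' [_ ->]; rewrite subn0.
    apply: (@wp_whilebit _ _ (fun j s' => j <= p n /\
      s' = set_ipos (set_reg s d (p n - j)) (size (code p n) + (p n - j))) _ _ (p n)).
    + by move=> j s'' [lej ->] /=; rewrite code_wordE; lia.
    + move=> j s'' [lej ->]; apply: wp_seq; apply: wp_op; apply: wp_seq.
      by do 2!apply: wp_op; split; [lia|solve_rstate_eq].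
    + by move=> s'' [_ ->]; rewrite subn0; exact: Qs.
    + by split => //; rewrite subnn; solve_rstate_eq.
  - by split => //; rewrite subnn /n; solve_rstate_eq.
- by solve_rstate_eq.
Qed.

(** * Compilation of primitive recursive functionals *)

(* Primitive recursive functions relative to an oracle, unary up to [cpair]. *)
Inductive fcode :=
  | FId | FZero | FSucc | FFst | FSnd | FOrc
  | FComp of fcode & fcode | FPair of fcode & fcode | FPrec of fcode & fcode.

Fixpoint feval (p : baire) (f : fcode) (n : nat) : nat :=
  match f with
  | FId => n
  | FZero => 0
  | FSucc => n.+1
  | FFst => (cunpair n).1
  | FSnd => (cunpair n).2
  | FOrc => p n
  | FComp f g => feval p f (feval p g n)
  | FPair f g => cpair (feval p f n) (feval p g n)
  | FPrec z s => let x := (cunpair n).1 in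
      nat_rect (fun=> nat) (feval p z x)
        (fun i acc => feval p s (cpair x (cpair i acc))) (cunpair n).2
  end.

(* The argument and the value are in register [d]; the registers above [d] are
   free for scratch work, and so is register 1. *)
Fixpoint fcompile (f : fcode) d : cmd :=
  match f with
  | FId => CSkip
  | FZero => clear_reg d
  | FSucc => COp (Inc d)
  | FFst => prog_unpair d
  | FSnd => prog_unpair d ;; clear_reg d ;; move_reg d.+1 d
  | FOrc => prog_orc d
  | FComp f g => fcompile g d ;; fcompile f d
  | FPair f g =>
      copy_reg d d.+1 ;; fcompile g d.+1 ;; copy_reg d d.+2 ;; fcompile f d.+2 ;;
      clear_reg d ;; move_reg d.+2 d ;; prog_pair d
  | FPrec z s =>
      prog_unpair d ;; copy_reg d d.+2 ;; fcompile z d.+2 ;; clear_reg d.+3 ;;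
      CWhile d.+1 (COp (Dec d.+1) ;;
        copy_reg d d.+4 ;; copy_reg d.+3 d.+4.+1 ;; copy_reg d.+2 d.+4.+2 ;;
        prog_pair d.+4.+1 ;; prog_pair d.+4 ;; fcompile s d.+4 ;;
        clear_reg d.+2 ;; move_reg d.+4 d.+2 ;; COp (Inc d.+3)) ;;
      clear_reg d ;; move_reg d.+2 d
  end.

(** The calling convention: the registers from 2 up to [d] excluded survive, and register 0 still
    mirrors the input head. *)
Definition post d s v s' :=
  [/\ regs s' 0 = ipos s', outp s' = outp s,
      forall r, 1 < r < d -> regs s' r = regs s r & regs s' d = v].

Ltac simpl_regs := rewrite /=; repeat match goal with |- context[?a == ?b] =>
  first [rewrite (_ : (a == b) = false); last by lia
        |rewrite (_ : (a == b) = true); last by lia] end.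

Lemma wp_fcompile p f d s : 1 < d -> regs s 0 = ipos s ->
  wp (code_word p) (fcompile f d) (post d s (feval p f (regs s d))) s.
Proof.
elim: f d s => [||||||f IHf g IHg|f IHf g IHg|z IHz f IHf] d s d1 s0 /=.
- exact: wp_skip.
- by apply: wp_clear; split => //= *; solve_regs.
- by apply: wp_op; split => //= *; solve_regs.
- by apply: wp_unpair; split => //= *; solve_regs.
- apply: wp_seq; apply: wp_unpair; apply: wp_seq; apply: wp_clear.
  by apply: wp_move; first lia; split => //= *; solve_regs.
- by apply: wp_orc => // x; split => //= *; solve_regs.
- apply: wp_seq; apply: wp_weaken (IHg _ _ d1 s0) _ => s1 [s10 o1 r1 e1].
  apply: wp_weaken (IHf _ _ d1 s10) _ => s2 [s20 o2 r2 e2].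
  split => //; [by rewrite o2|by move=> r rd; rewrite r2 ?r1|by rewrite e2 e1].
- apply: wp_seq; apply: wp_copy; [lia..|]; apply: wp_seq.
  apply: wp_weaken (IHg _ _ _ _) _; [lia|by move=> /=; solve_regs|].
  move=> s1 [s10 o1 r1 e1].
  apply: wp_seq; apply: wp_copy; [lia..|]; apply: wp_seq.
  apply: wp_weaken (IHf _ _ _ _) _; [lia|by move=> /=; solve_regs|].
  move=> s2 [s20 o2 r2 e2].
  apply: wp_seq; apply: wp_clear; apply: wp_seq; apply: wp_move; first lia.
  apply: wp_pair.
  have E1 : regs s1 d = regs s d by rewrite r1 /=; [solve_regs|lia].
  have E2 : regs s2 d.+1 = feval p g (regs s d).
    by rewrite r2 /=; last lia; move: e1 => /=; rewrite eqxx /=; solve_regs.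
  have E3 : regs s2 d.+2 = feval p f (regs s d).
    by rewrite e2 /= eqxx /= E1.
  split => /=.
  + by solve_regs.
  + by rewrite o2 /= o1.
  + move=> r rd; have -> : regs s r = regs s2 r; last by solve_regs.
    by rewrite r2 /= ?r1 /=; [solve_regs|lia..].
  + by simpl_regs; rewrite add0n E2 E3.
- apply: wp_seq; apply: wp_unpair; apply: wp_seq; apply: wp_copy; [lia..|].
  apply: wp_seq; apply: wp_weaken (IHz _ _ _ _) _; [lia|by simpl_regs|].
  move=> s1 [s10 o1 r1 e1]; apply: wp_seq; apply: wp_clear; apply: wp_seq.
  move: e1; simpl_regs => e1.
  set x := (cunpair _).1 in e1 *; set n := (cunpair _).2; set R := nat_rect _ _ _.
  (* Register [d] keeps the parameter, [d.+1] the rounds left, [d.+2] the accumulator and [d.+3] the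
     index of the round. *)
  apply: (@wp_while _ _ _ (fun j s' => j <= n /\
    ([/\ regs s' 0 = ipos s', outp s' = outp s &
        forall r, 1 < r < d -> regs s' r = regs s r] /\
    [/\ regs s' d = x, regs s' d.+1 = j, regs s' d.+2 = R (n - j)
      & regs s' d.+3 = n - j])) _ _ n).
  + by move=> j s' [_ [_ []]].
  + move=> j s' [lej [[s'0 o' r'] [ex en ea ei]]].
    apply: wp_seq; apply: wp_op; do 3!(apply: wp_seq; apply: wp_copy; [lia..|]).
    do 2!(apply: wp_seq; apply: wp_pair); apply: wp_seq.
    apply: wp_weaken (IHf _ _ _ _) _; [lia|by simpl_regs|].
    move=> s2 [s20 o2 r2]; simpl_regs; rewrite ex ea ei => e2.
    apply: wp_seq; apply: wp_clear; apply: wp_seq; apply: wp_move; first lia.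
    apply: wp_op; split; first lia; split; split; simpl_regs.
    * by [].
    * by rewrite o2.
    * by move=> r rd; simpl_regs; rewrite r2; [simpl_regs; exact: r'|lia].
    * by rewrite r2; [simpl_regs|lia].
    * by rewrite r2; [simpl_regs; rewrite en|lia].
    * by rewrite e2 add0n; have -> : n - j = (n - j.+1).+1 by lia.
    * by rewrite r2; [simpl_regs; lia|lia].
  + move=> s' [_ [[s'0 o' r'] [ex en ea ei]]].
    apply: wp_seq; apply: wp_clear; apply: wp_move; first lia.
    split; simpl_regs => //; last by rewrite ea subn0.
    by move=> r rd; simpl_regs; exact: r'.
  + split => //; rewrite subnn; split; split; simpl_regs => //.
    * by move=> r rd; simpl_regs; rewrite r1; [simpl_regs|lia].
    * by rewrite r1; [simpl_regs|lia].
    * by rewrite r1; [simpl_regs|lia].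
Qed.

(** * Output in stages *)

Definition emitted (g : baire -> nat -> nat) p t : seq nat :=
  pmap (fun i => if g p i is v.+1 then Some v else None) (iota 0 t).

Lemma emittedS g p t : emitted g p t.+1 =
  emitted g p t ++ if g p t is v.+1 then [:: v] else [::].
Proof. by rewrite /emitted -addn1 iotaD pmap_cat /=; case: (g p _). Qed.

(* [g p i] is 0 when stage [i] outputs nothing and [v.+1] when it outputs [v]. *)
Program Definition emits (g : baire -> nat -> nat) : pfun baire baire :=
  @PFun baire baire (fun p q =>
    forall n, exists t, prefix (mkseq q n) (emitted g p t)) _.
Next Obligation.
move=> g p q q' pq pq'; apply/funext => n.
have mono t t' : t <= t' -> prefix (emitted g p t) (emitted g p t').
  by move=> /subnKC <-; rewrite /emitted iotaD pmap_cat prefix_prefix.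
have [t ht] := pq n.+1; have [t' ht'] := pq' n.+1.
have /prefixP[l el] := prefix_trans ht (mono _ _ (leq_maxl t t')).
have /prefixP[l' el'] := prefix_trans ht' (mono _ _ (leq_maxr t t')).
move: el; rewrite el' => /(congr1 (fun l => nth 0 l n)).
by rewrite !nth_cat !size_mkseq ltnSn !nth_mkseq.
Qed.

(** One stage: register 2 holds its number, register 3 the value at it. A positive value is printed
    in unary after removing the offset 1. *)
Definition driver f :=
  copy_reg 2 3 ;; fcompile f 3 ;;
  CIf 3 (COp (Dec 3) ;; CWhile 3 (COp (Dec 3) ;; COp (Out true)) ;;
         COp (Out false)) CSkip ;;
  COp (Inc 2).

Definition bits (l : seq nat) := flatten [seq rcons (nseq v true) false | v <- l].

Lemma wp_driver p f s : regs s 0 = ipos s ->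
  wp (code_word p) (driver f) (fun s' => [/\ regs s' 0 = ipos s',
    regs s' 2 = (regs s 2).+1 & outp s' = outp s ++
     if feval p f (regs s 2) is v.+1 then rcons (nseq v true) false else [::]]) s.
Proof.
move=> s0; apply: wp_seq; apply: wp_copy => //; apply: wp_seq.
apply: wp_weaken (wp_fcompile _ _ _ _) _ => // s1 [s10 o1 /(_ 2 isT) /= r1 /= e1].
apply: wp_seq; apply: wp_if; rewrite e1; case: eqP.
  by move=> ->; apply: wp_skip; apply: wp_op; rewrite cats0; split => //=; rewrite r1.
case: (feval _ _ _) e1 => // v e1 _; apply: wp_seq; apply: wp_op; apply: wp_seq.
apply: (@wp_while _ _ _ (fun j s' => j <= v /\
  s' = St (regs (set_reg s1 3 j)) (ipos s1) (outp s1 ++ nseq (v - j) true)) _ _ v).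
- by move=> j s' [_ ->].
- move=> j s' [lej ->]; apply: wp_seq; do 2!apply: wp_op; split; first lia.
  apply: rstate_ext => //=; first by move=> i; case: eqP.
  by have -> : v - j = v - j.+1 + 1 by [lia]; rewrite nseqD catA.
- move=> s' [_ ->]; do 2!apply: wp_op; split => //=; first by rewrite r1.
  by rewrite subn0 o1 -cats1 catA.
- by split => //; rewrite subnn cats0; apply: rstate_ext => //= i; case: eqP; rewrite ?e1.
Qed.

(** The driver is put into an endless loop; on reaching address 0 after [t] rounds, the machine has
    printed the code of [emitted g p t]. *)
Theorem emits_pcomputable g f : (forall p n, feval p f n = g p n) ->
  pcomputable (emits g).
Proof.
move=> fE; pose C := rcons (flat 0 (driver f)) (IJmp 0).
exists (rmachine C) => p q pq n.
suff H t : exists m s, [/\ iter m (fstep (code_word p) C) (0, start_rstate) = (0, s),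
    regs s 0 = ipos s, regs s 2 = t & outp s = bits (emitted g p t)].
  have [t /prefixP[l el]] := pq n; have [m [s [em _ _ os]]] := H t.
  exists m.+1; have := simulates_iter C (code_word p) m; rewrite em.
  case=> _ _ -> _ _; rewrite os el /bits map_cat flatten_cat.
  by rewrite /mkseq -map_comp prefix_prefix.
elim: t => [|t [m [s [em s0 <- os]]]]; first by exists 0, start_rstate.
have [s' rs' [s'0 e2 o']] := @wp_driver p f s s0.
have [] := @reach_flat _ C _ _ _ 0 rs'.
  by exists [::], [:: IJmp 0]; rewrite cats1.
move=> k ek; exists (k + m).+1, s'; split => //.
  have CE x : nth x C (clen (driver f)) = IJmp 0.
    by rewrite nth_rcons size_flat ltnn eqxx.
  by rewrite iterS iterD em ek /fstep add0n -/(clen (driver f)) CE.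
rewrite o' os emittedS /bits map_cat flatten_cat fE.
by case: (g p _) => //= v; rewrite cats0.
Qed.

(** * Typed primitive recursive functionals *)

Class coded (T : Type) := cd : T -> nat.
#[local] Instance coded_nat : coded nat := id.
#[local] Instance coded_bool : coded bool := nat_of_bool.
#[local] Instance coded_prod (T U : Type) (cT : coded T) (cU : coded U) : coded (T * U) :=
  fun x => cpair (cd x.1) (cd x.2).

(** One code serves all oracles [p]; this uniformity is what a machine with [p] on its input tape
    requires. *)
Variant primrec {T U : Type} {cT : coded T} {cU : coded U}
    (f : baire -> T -> U) : Prop :=
  Primrec c of forall p x, feval p c (cd x) = cd (f p x).

Section Closure.
Context {T U V : Type} {cT : coded T} {cU : coded U} {cV : coded V}.

Lemma primrec_id : primrec (fun p (x : T) => x).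
Proof. by exists FId. Qed.

Lemma primrec_comp (g : baire -> U -> V) (f : baire -> T -> U) :
  primrec g -> primrec f -> primrec (fun p x => g p (f p x)).
Proof. by move=> [c cE] [d dE]; exists (FComp c d) => p x /=; rewrite dE cE. Qed.

Lemma primrec_pair (f : baire -> T -> U) (g : baire -> T -> V) :
  primrec f -> primrec g -> primrec (fun p x => (f p x, g p x)).
Proof. by move=> [c cE] [d dE]; exists (FPair c d) => p x /=; rewrite dE cE. Qed.

Lemma primrec_fst (f : baire -> T -> U * V) : primrec f -> primrec (fun p x => (f p x).1).
Proof. by move=> [c cE]; exists (FComp FFst c) => p x /=; rewrite cE cpairK. Qed.

Lemma primrec_snd (f : baire -> T -> U * V) : primrec f -> primrec (fun p x => (f p x).2).
Proof. by move=> [c cE]; exists (FComp FSnd c) => p x /=; rewrite cE cpairK. Qed.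

Lemma primrec_const (v : U) : primrec (fun p (x : T) => v).
Proof.
exists (iter (cd v) (FComp FSucc) FZero) => p x.
by elim: (cd v) => //= n ->.
Qed.

Lemma primrec_succ (f : baire -> T -> nat) : primrec f -> primrec (fun p x => (f p x).+1).
Proof. by move=> [c cE]; exists (FComp FSucc c) => p x /=; rewrite cE. Qed.

Lemma primrec_orc (f : baire -> T -> nat) : primrec f -> primrec (fun p x => p (f p x)).
Proof. by move=> [c cE]; exists (FComp FOrc c) => p x /=; rewrite cE. Qed.

Lemma primrec_rec (n : baire -> T -> nat) (z : baire -> T -> U)
    (s : baire -> T -> nat -> U -> U) :
  primrec n -> primrec z -> primrec (fun p (y : T * (nat * U)) => s p y.1 y.2.1 y.2.2) ->
  primrec (fun p x => nat_rect (fun=> U) (z p x) (s p x) (n p x)).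
Proof.
move=> [a aE] [b bE] [c cE]; exists (FComp (FPrec b c) (FPair FId a)) => p x /=.
rewrite aE cpairK /= bE [cd (n p x)]/cd /coded_nat /=.
elim: (n p x) => //= i IHi; rewrite IHi.
by rewrite -(cE p (x, (i, nat_rect (fun=> U) (z p x) (s p x) i))).
Qed.

Lemma primrec_iter (n : baire -> T -> nat) (z : baire -> T -> U)
    (s : baire -> T -> U -> U) :
  primrec n -> primrec z -> primrec (fun p (y : T * U) => s p y.1 y.2) ->
  primrec (fun p x => iter (n p x) (s p x) (z p x)).
Proof.
move=> cn cz [c cE].
have cs : primrec (fun p (y : T * (nat * U)) => s p y.1 y.2.2).
  exists (FComp c (FPair FFst (FComp FSnd FSnd))) => p [x [i u]] /=.
  rewrite [cd (x, (i, u))]/cd /coded_prod cpairK /=.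
  by rewrite [cd (i, u)]/cd cpairK /= -(cE p (x, u)).
have [d dE] := primrec_rec (s := fun p x _ u => s p x u) cn cz cs; by exists d.
Qed.

Lemma primrec_if (b : baire -> T -> bool) (f g : baire -> T -> U) :
  primrec b -> primrec f -> primrec g -> primrec (fun p x => if b p x then f p x else g p x).
Proof.
move=> [c cE] [d dE] [e eE].
(* The boolean is used as the length, 0 or 1, of a recursion. *)
exists (FComp (FPrec e (FComp d FFst)) (FPair FId c)) => p x /=.
by rewrite cE cpairK /=; case: (b p x) => /=; rewrite ?cpairK ?dE ?eE.
Qed.

End Closure.

Lemma primrec2 (T U V W : Type)
    (cT : coded T) (cU : coded U) (cV : coded V) (cW : coded W)
    (f : U -> V -> W) (a : baire -> T -> U) (b : baire -> T -> V) :
  primrec (fun p (y : U * V) => f y.1 y.2) -> primrec a -> primrec b ->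
  primrec (fun p x => f (a p x) (b p x)).
Proof.
by move=> cf ca cb; apply: (primrec_comp (g := fun p (y : U * V) => f y.1 y.2)
  (f := fun p x => (a p x, b p x)) cf); exact: primrec_pair.
Qed.

Lemma primrec1 (T U W : Type) (cT : coded T) (cU : coded U) (cW : coded W)
    (f : U -> W) (a : baire -> T -> U) :
  primrec (fun p (y : U) => f y) -> primrec a -> primrec (fun p x => f (a p x)).
Proof. by move=> cf ca; exact: (primrec_comp (g := fun p y => f y)). Qed.

Section Arithmetic.
Context {T : Type} {cT : coded T}.
Implicit Types (a b : baire -> T -> nat) (c d : baire -> T -> bool).

Lemma primrec_pred a : primrec a -> primrec (fun p x => (a p x).-1).
Proof.
apply: (primrec1 (f := predn)).
have : primrec (fun p (x : nat) => nat_rect (fun=> nat) 0 (fun i _ => i) x).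
  by apply: primrec_rec; [exact: primrec_id|exact: primrec_const|
    exact/primrec_fst/primrec_snd/primrec_id].
by move=> [e eE]; exists e => p [|x]; rewrite eE.
Qed.

Lemma primrec_case (U : Type) (cU : coded U) a
    (f : baire -> T -> nat -> U) (g : baire -> T -> U) :
  primrec a -> primrec g -> primrec (fun p (y : T * nat) => f p y.1 y.2) ->
  primrec (fun p x => if a p x is n.+1 then f p x n else g p x).
Proof.
move=> ca cg cf.
have : primrec (fun p x => nat_rect (fun=> U) (g p x) (fun i _ => f p x i) (a p x)).
  apply: primrec_rec => //; apply: (primrec_comp (g := fun p (y : T * nat) => f p y.1 y.2)
    (f := fun p (y : T * (nat * U)) => (y.1, y.2.1))) => //.
  apply: primrec_pair; first exact/primrec_fst/primrec_id.
  exact/primrec_fst/primrec_snd/primrec_id.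
by move=> [e eE]; exists e => p x; rewrite eE; case: (a p x).
Qed.

End Arithmetic.

Section Arithmetic2.
Context {T : Type} {cT : coded T}.
Implicit Types (a b : baire -> T -> nat) (c d : baire -> T -> bool).

Lemma primrec_add a b : primrec a -> primrec b -> primrec (fun p x => a p x + b p x).
Proof.
apply: (primrec2 (f := addn)); have : primrec (fun p (y : nat * nat) => iter y.1 succn y.2).
  by apply: primrec_iter; [exact/primrec_fst/primrec_id|exact/primrec_snd/primrec_id|
    exact/primrec_succ/primrec_snd/primrec_id].
by move=> [e eE]; exists e => p x; rewrite eE iter_succn addnC.
Qed.

Lemma primrec_sub a b : primrec a -> primrec b -> primrec (fun p x => a p x - b p x).
Proof.
apply: (primrec2 (f := subn)); have : primrec (fun p (y : nat * nat) => iter y.2 predn y.1).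
  by apply: primrec_iter; [exact/primrec_snd/primrec_id|exact/primrec_fst/primrec_id|
    exact/primrec_pred/primrec_snd/primrec_id].
by move=> [e eE]; exists e => p x; rewrite eE iter_predn.
Qed.

Lemma primrec_leq a b : primrec a -> primrec b -> primrec (fun p x => a p x <= b p x).
Proof.
move=> ca cb.
have [e eE] : primrec (fun p x => if a p x - b p x is _.+1 then false else true).
  by apply: primrec_case; [exact: primrec_sub|exact: primrec_const|exact: primrec_const].
by exists e => p x; rewrite eE /leq; case: (_ - _).
Qed.

Lemma primrec_and c d : primrec c -> primrec d -> primrec (fun p x => c p x && d p x).
Proof. by move=> cc cd; apply: primrec_if => //; exact: primrec_const. Qed.

Lemma primrec_neg c : primrec c -> primrec (fun p x => ~~ c p x).
Proof. by move=> cc; apply: primrec_if => //; exact: primrec_const. Qed.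

Lemma primrec_eq a b : primrec a -> primrec b -> primrec (fun p x => a p x == b p x).
Proof.
move=> ca cb; have [e eE] := primrec_and (primrec_leq ca cb) (primrec_leq cb ca).
by exists e => p x; rewrite eE eqn_leq.
Qed.

Lemma primrec_max a b : primrec a -> primrec b -> primrec (fun p x => maxn (a p x) (b p x)).
Proof.
move=> ca cb; rewrite /maxn; apply: primrec_if => //.
by apply: primrec_leq => //; exact: primrec_succ.
Qed.

Lemma primrec_cpair a b : primrec a -> primrec b -> primrec (fun p x => cpair (a p x) (b p x)).
Proof. by move=> ca cb; have [e eE] := primrec_pair ca cb; exists e. Qed.

Lemma primrec_cunpair a : primrec a -> primrec (fun p x => cunpair (a p x)).
Proof. by move=> [e eE]; exists e => p x; rewrite eE /cd /= /coded_prod cunpairK. Qed.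

Lemma primrec_nat_of_bool c : primrec c -> primrec (fun p x => nat_of_bool (c p x)).
Proof. by move=> [e eE]; exists e. Qed.

End Arithmetic2.

Ltac primrec_auto := repeat first
  [ assumption
  | exact: primrec_const
  | lazymatch goal with
    | |- primrec (fun p x => x) => exact: primrec_id
    | |- primrec (fun p x => (_, _)) => apply: primrec_pair
    | |- primrec (fun p x => fst _) => apply: primrec_fst
    | |- primrec (fun p x => snd _) => apply: primrec_snd
    | |- primrec (fun p x => if _ then _ else _) => apply: primrec_if
    | |- primrec (fun p x => S _) => apply: primrec_succ
    | |- primrec (fun p x => predn _) => apply: primrec_pred
    | |- primrec (fun p x => addn _ _) => apply: primrec_add
    | |- primrec (fun p x => subn _ _) => apply: primrec_sub
    | |- primrec (fun p x => maxn _ _) => apply: primrec_max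
    | |- primrec (fun p x => leq _ _) => apply: primrec_leq
    | |- primrec (fun p x => andb _ _) => apply: primrec_and
    | |- primrec (fun p x => negb _) => apply: primrec_neg
    | |- primrec (fun p x => eq_op _ _) => apply: primrec_eq
    | |- primrec (fun p x => cpair _ _) => apply: primrec_cpair
    | |- primrec (fun p x => cunpair _) => apply: primrec_cunpair
    | |- primrec (fun p x => nat_of_bool _) => apply: primrec_nat_of_bool
    | |- primrec (fun p x => iter _ _ _) => apply: primrec_iter
    | |- primrec (fun p x => p _) => apply: primrec_orc
    end ].

Lemma primrec_half_odd (T : Type) (cT : coded T) (a : baire -> T -> nat) : primrec a ->
  primrec (fun p x => ((a p x)./2, odd (a p x))).
Proof.
apply: (primrec1 (f := fun n => (n./2, odd n))).
(* The parity alternates, and adding it to the first component counts every second step. *)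
have [e eE] : primrec (fun p (n : nat) =>
    iter n (fun y : nat * bool => (y.1 + y.2, ~~ y.2)) (0, false)) by primrec_auto.
exists e => p n; rewrite eE; congr cd.
by elim: n => //= n ->; rewrite /= addnC uphalf_half.
Qed.

Lemma primrec_half (T : Type) (cT : coded T) (a : baire -> T -> nat) : primrec a ->
  primrec (fun p x => (a p x)./2).
Proof. by move=> /primrec_half_odd /primrec_fst. Qed.

Lemma primrec_odd (T : Type) (cT : coded T) (a : baire -> T -> nat) : primrec a ->
  primrec (fun p x => odd (a p x)).
Proof. by move=> /primrec_half_odd /primrec_snd. Qed.

Lemma primrec_double (T : Type) (cT : coded T) (a : baire -> T -> nat) : primrec a ->
  primrec (fun p x => (a p x).*2).
Proof. by move=> ca; have [e eE] := primrec_add ca ca; exists e => p x; rewrite eE addnn. Qed.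

(* A number [z] also codes the sequence [entry z] of finite support. *)
Definition entry (z j : nat) : nat := (cunpair (iter j (fun z => (cunpair z).2) z)).1.

(** Built from the last entry to the first, hence the reversed index. The tail 0 codes the zero
    sequence, since [cunpair 0] is [(0, 0)]. *)
Definition encode (B : nat) (f : nat -> nat) : nat :=
  nat_rect (fun=> nat) 0 (fun i acc => cpair (f (B - i.+1)) acc) B.

(** The bound is large enough because a code [z] has no nonzero entry at an index from [z] on. *)
Definition set_entry (z i v : nat) : nat :=
  encode (maxn z i.+1) (fun j => if j == i then v else entry z j).

Lemma entryS z j : entry z j.+1 = entry (cunpair z).2 j.
Proof. by rewrite /entry iterSr. Qed.

Lemma entry0 j : entry 0 j = 0.
Proof. by elim: j => // j IHj; rewrite entryS. Qed.

Lemma entry_encode B f j : entry (encode B f) j = if j < B then f j else 0.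
Proof.
pose g i acc := cpair (f (B - i.+1)) acc.
have H n j' : n <= B ->
    entry (nat_rect (fun=> nat) 0 g n) j' = if j' < n then f (B - n + j') else 0.
  elim: n j' => [|n IHn] j' len /=; first exact: entry0.
  case: j' => [|j']; first by rewrite /entry /= /g cpairK /= addn0.
  rewrite entryS /g cpairK /= IHn; last by lia.
  by rewrite ltnS; case: ifP => // ltj; congr f; lia.
by rewrite /encode -/g H // subnn.
Qed.

Lemma eq_encode B (f g : nat -> nat) :
  (forall j, j < B -> f j = g j) -> encode B f = encode B g.
Proof.
move=> fg; rewrite /encode.
suff H n : n <= B -> nat_rect (fun=> nat) 0 (fun i acc => cpair (f (B - i.+1)) acc) n =
    nat_rect (fun=> nat) 0 (fun i acc => cpair (g (B - i.+1)) acc) n by exact: H.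
by elim: n => //= n IHn ltn; rewrite IHn ?(ltnW ltn) // fg //; lia.
Qed.

(** The second component of a positive code is smaller than the code, so the tail reaches 0 after at
    most [z] steps. *)
Lemma entry_default z j : z <= j -> entry z j = 0.
Proof.
elim: j z => [|j IHj] z lez; first by rewrite (_ : z = 0) ?entry0 //; lia.
rewrite entryS; case: z lez => [|z] lez; first exact: entry0.
apply: IHj; have := cunpairK z.+1; case: (cunpair _) => n k /=; rewrite /cpair => E.
suff : 0 < n + k -> 0 < ((n + k) * (n + k).+1)./2.
  move: E; case: (posnP (n + k)) => [|_]; last by lia.
  by move=> nk0; rewrite nk0 /=; lia.
by case: (n + k) => // m _; rewrite tri_succ addnS.
Qed.

Lemma entry_set z i v j : entry (set_entry z i v) j = if j == i then v else entry z j.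
Proof.
rewrite /set_entry entry_encode leq_max !ltnS; case: eqP => [->|ne].
  by rewrite leqnn orbT.
by case: ltnP => //= lez; rewrite entry_default // if_same.
Qed.

Lemma primrec_entry (T : Type) (cT : coded T) (a b : baire -> T -> nat) :
  primrec a -> primrec b -> primrec (fun p x => entry (a p x) (b p x)).
Proof. by apply: (primrec2 (f := entry)); rewrite /entry; primrec_auto. Qed.

Lemma primrec_encode (T : Type) (cT : coded T) (B : baire -> T -> nat)
    (f : baire -> T -> nat -> nat) :
  primrec B -> primrec (fun p (y : T * nat) => f p y.1 y.2) ->
  primrec (fun p x => encode (B p x) (f p x)).
Proof.
move=> cB cf; rewrite /encode.
apply: (primrec_rec (s := fun p x i acc => cpair (f p x (B p x - i.+1)) acc)) => //.
  exact: primrec_const.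
apply: primrec_cpair; last by primrec_auto.
apply: (primrec_comp (g := fun p (y : T * nat) => f p y.1 y.2)
  (f := fun p (y : T * (nat * nat)) => (y.1, B p y.1 - y.2.1.+1))) => //.
primrec_auto; apply: (primrec_comp (g := B)) => //; primrec_auto.
Qed.

Lemma primrec_set_entry (T : Type) (cT : coded T) (a b c : baire -> T -> nat) :
  primrec a -> primrec b -> primrec c ->
  primrec (fun p x => set_entry (a p x) (b p x) (c p x)).
Proof.
move=> ca cb cc.
apply: (primrec_comp (g := fun p (y : nat * (nat * nat)) => set_entry y.1 y.2.1 y.2.2)
  (f := fun p x => (a p x, (b p x, c p x)))); last by primrec_auto.
rewrite /set_entry.
apply: (primrec_encode
  (f := fun p y j => if j == y.2.1 then y.2.2 else entry y.1 j)); primrec_auto.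
by apply: primrec_entry; primrec_auto.
Qed.

Lemma pcomputable_sub (F G : pfun baire baire) :
  (forall p q, F p q -> G p q) -> pcomputable G -> pcomputable F.
Proof. by move=> FG [M MG]; exists M => p q /FG /MG. Qed.

Lemma emits_primrec (g : baire -> nat -> nat) : primrec g -> pcomputable (emits g).
Proof. by move=> [e eE]; apply: (@emits_pcomputable g e). Qed.

Lemma total_primrec (A : baire -> baire) : primrec (fun p (n : nat) => A p n) ->
  pcomputable (Defs.total A).
Proof.
move=> cA; apply: (@pcomputable_sub _ (emits (fun p n => (A p n).+1))); last first.
  by apply: emits_primrec; exact: primrec_succ.
move=> p _ -> n; exists n; rewrite /emitted /mkseq.
by elim: n 0 => //= n IHn i; rewrite eqxx IHn.
Qed.

Ltac primrec_auto_full := repeat first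
  [ progress primrec_auto
  | lazymatch goal with
    | |- primrec (fun p x => half _) => apply: primrec_half
    | |- primrec (fun p x => odd _) => apply: primrec_odd
    | |- primrec (fun p x => double _) => apply: primrec_double
    | |- primrec (fun p x => entry _ _) => apply: primrec_entry
    | |- primrec (fun p x => set_entry _ _ _) => apply: primrec_set_entry
    | |- primrec (fun p x => encode _ _) => apply: primrec_encode
    end ].

(** * Simulation of machines *)

(** A position in the code word is kept as block number and offset in the block; reading it then
    needs no length of a code. *)
Definition bitpos (f : nat -> nat) (y : nat * nat) : nat * nat :=
  if y.2 < f y.1 then (y.1, y.2.+1) else (y.1.+1, 0).

Lemma code_word_bitpos (q : baire) j :
  code_word q j =
  ((iter j (bitpos q) (0, 0)).2 < q (iter j (bitpos q) (0, 0)).1).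
Proof.
set y := iter j _ _.
have [-> le] : j = size (code q y.1) + y.2 /\ y.2 <= q y.1; last by rewrite code_wordE.
rewrite /y {y}; elim: j => //= j; case: (iter j _ _) => i r /= [-> le].
rewrite /bitpos /=; case: ltnP => ler /=; split => //; first by rewrite addnS.
by rewrite size_codeS; lia.
Qed.

Lemma primrec_code_word (T : Type) (cT : coded T)
    (a : baire -> T -> baire) (h : baire -> T -> nat) :
  primrec (fun p (y : T * nat) => a p y.1 y.2) -> primrec h ->
  primrec (fun p x => code_word (a p x) (h p x)).
Proof.
move=> ca ch.
have cay (U : Type) (cU : coded U) (u : baire -> U -> T) (n : baire -> U -> nat) :
    primrec u -> primrec n -> primrec (fun p x => a p (u p x) (n p x)).
  move=> cu cn; apply: (primrec_comp (g := fun p (y : T * nat) => a p y.1 y.2)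
     (f := fun p x => (u p x, n p x))) => //; exact: primrec_pair.
have cit : primrec (fun p x => iter (h p x) (bitpos (a p x)) (0, 0)).
  apply: primrec_iter => //; [exact: primrec_const|rewrite /bitpos; primrec_auto].
  by apply: cay; primrec_auto.
have [e eE] : primrec (fun p x => (iter (h p x) (bitpos (a p x)) (0, 0)).2 <
   a p x (iter (h p x) (bitpos (a p x)) (0, 0)).1).
  by primrec_auto; apply: cay; primrec_auto.
by exists e => p x; rewrite eE code_word_bitpos.
Qed.

(* The state [(r, c)] of an observer of the output that waits for the value of
   index [i]: [r] terminators are still to come and, when [r] is 0, the value
   is [c]. *)
Definition obs (o : nat * nat) (b : bool) : nat * nat :=
  if b then (o.1, if o.1 == 1 then o.2.+1 else o.2) else (o.1.-1, o.2).

Definition observe (M : machine) (q : baire) t i :=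
  foldl obs (i.+1, 0) (written (iter t (step (code_word q)) (init M))).

Section FiniteTables.
Context {F : eqType} {U : Type}.

(** A finite table unrolled into nested conditionals, which are primitive recursive. *)
Definition lookup (k : F -> nat) (l : seq F) (n : nat) (g : F -> U) (d : U) :=
  foldr (fun y r => if k y == n then g y else r) d l.

Lemma lookupE k l y g d : injective k -> y \in l -> lookup k l (k y) g d = g y.
Proof.
move=> kI; elim: l => //= z l IHl; rewrite inE (inj_eq kI).
by case: eqP => [->|/eqP ne]; rewrite ?eqxx //= eq_sym (negPf ne).
Qed.

Lemma primrec_lookup (T : Type) (cT : coded T) (cU : coded U) k l
    (n : baire -> T -> nat) (g : F -> baire -> T -> U) (d : baire -> T -> U) :
  primrec n -> (forall y, primrec (g y)) -> primrec d ->
  primrec (fun p x => lookup k l (n p x) (fun y => g y p x) (d p x)).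
Proof. by move=> cn cg cd; elim: l => //= y l IHl; primrec_auto; exact: cg. Qed.

Definition set_entries (Z : nat) (l : seq F) (key val : F -> nat) :=
  foldl (fun Z i => set_entry Z (key i) (val i)) Z l.

Lemma entry_set_entries Z l key val i : injective key ->
  entry (set_entries Z l key val) (key i) = if i \in l then val i else entry Z (key i).
Proof.
move=> kI; elim: l Z => //= j l IHl Z; rewrite IHl entry_set inE (inj_eq kI).
by case: eqP => [->|] //=; case: ifP.
Qed.

Lemma entry_set_entries_out Z l key val j : (forall i, key i != j) ->
  entry (set_entries Z l key val) j = entry Z j.
Proof.
move=> kj; elim: l Z => //= i l IHl Z; rewrite IHl entry_set.
by rewrite eq_sym (negPf (kj i)).
Qed.

Lemma primrec_set_entries (T : Type) (cT : coded T) l (Z : baire -> T -> nat)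
    (key val : F -> baire -> T -> nat) :
  primrec Z -> (forall i, primrec (key i)) -> (forall i, primrec (val i)) ->
  primrec (fun p x => set_entries (Z p x) l (fun i => key i p x) (fun i => val i p x)).
Proof.
move=> cZ ck cv; elim: l Z cZ => //= i l IHl Z cZ.
apply: (IHl (fun p x => set_entry (Z p x) (key i p x) (val i p x))).
exact: primrec_set_entry.
Qed.

End FiniteTables.

Section Simulation.
Variable M : machine.

(** The blank gets code 0, so that the number 0 represents the empty work tapes with their heads at
    cell 0. *)
Definition scode (a : symb M) : nat :=
  if a == blank M then 0 else (enum_rank a).+1.

Lemma scode_inj : injective scode.
Proof.
move=> a b; rewrite /scode; case: eqP => [->|_]; case: eqP => [->|_] //.
by move=> [] /ord_inj /enum_rank_inj.
Qed.

Definition kcode (q b : nat) (f : 'I_(ntapes M) -> nat) :=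
  cpair q (cpair b (foldr (fun i acc => cpair (f i) acc) 0 (enum 'I_(ntapes M)))).

Definition input_key := (state M * bool * {ffun 'I_(ntapes M) -> symb M})%type.

Definition tkey (y : input_key) : nat :=
  kcode (enum_rank y.1.1) y.1.2 (fun i => scode (y.2 i)).

Lemma tkey_inj : injective tkey.
Proof.
move=> [[q b] f] [[q' b'] f']; rewrite /tkey /kcode /=.
move=> /cpair_inj[/ord_inj /enum_rank_inj -> /cpair_inj[eb ef]].
have -> : b = b' by move: eb; case: b b' => [] [].
congr (_, _); apply/ffunP => i; apply: scode_inj.
move: ef (mem_enum 'I_(ntapes M) i); elim: (enum _) => //= j l IHl.
move=> /cpair_inj[ej /IHl il]; rewrite inE => /orP[/eqP ->|] //.
Qed.

(* State, input head, contents and heads of the work tapes (cells at the keys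
   [cpair i.+1 j], heads at the keys [cpair 0 i]), observer. *)
Definition sim_conf := (nat * nat * nat * (nat * nat))%type.

Definition shead (Z : nat) (i : 'I_(ntapes M)) := entry Z (cpair 0 i).

Definition stape (Z : nat) (i : 'I_(ntapes M)) j := entry Z (cpair i.+1 j).

(** The transition function becomes a table over the finitely many input keys; the default [z] is
    not reached from a code of a configuration. *)
Definition sim_step (w : nat -> bool) (z : sim_conf) : sim_conf :=
  let: h := z.1.1.2 in let: Z := z.1.2 in
  lookup tkey (enum {: input_key})
    (kcode z.1.1.1 (w h) (fun i => stape Z i (shead Z i)))
    (fun y => let a := delta y.1.1 y.1.2 y.2 in
      (nat_of_ord (enum_rank (new_state a)), apply_move (input_move a) h,
       set_entries
         (set_entries Z (enum 'I_(ntapes M)) (fun i => cpair i.+1 (shead Z i))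
           (fun i => scode (work_write a i)))
         (enum 'I_(ntapes M)) (fun i => cpair 0 i)
         (fun i => apply_move (work_move a i) (shead Z i)),
       if output a is Some b then obs z.2 b else z.2)) z.

Definition sim_init i : sim_conf :=
  (nat_of_ord (enum_rank (start M)), 0, 0, (i.+1, 0)).

Definition represents i (z : sim_conf) (c : config M) :=
  [/\ z.1.1.1 = enum_rank (cstate c), z.1.1.2 = input_head c,
      forall j, shead z.1.2 j = work_head c j,
      forall j n, stape z.1.2 j n = scode (tape c j n)
    & z.2 = foldl obs (i.+1, 0) (written c)].

Lemma represents_step w i z c :
  represents i z c -> represents i (sim_step w z) (step w c).
Proof.
case: z => [[[q h] Z] o]; case: c => s h' tp wh wr [/= -> -> hE tE ->].
rewrite /sim_step /=.
pose y : input_key := (s, w h', [ffun i => tp i (wh i)]).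
have -> : kcode (enum_rank s) (w h') (fun i => stape Z i (shead Z i)) = tkey y.
  by congr kcode; apply/funext => j; rewrite hE tE /y /= ffunE.
rewrite (lookupE _ _ tkey_inj) ?mem_enum //= /step /=.
have head_inj : injective (fun j : 'I_(ntapes M) => cpair 0 j).
  by move=> j j' /cpair_inj[_ /ord_inj].
have cell_inj : injective (fun j : 'I_(ntapes M) => cpair j.+1 (shead Z j)).
  by move=> j j' /cpair_inj[[/ord_inj]].
split => //=.
- by move=> j; rewrite /shead entry_set_entries // mem_enum -/(shead Z j) hE.
(* Head keys have first component 0 and cell keys a positive one, so the two updates do not
   interfere. *)
- move=> j n; rewrite /stape entry_set_entries_out; last first.
    by move=> j'; apply/eqP => /cpair_inj[].
  case: eqP => [->|ne].
    by rewrite -hE entry_set_entries // mem_enum.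
  rewrite entry_set_entries_out; first exact: tE.
  move=> j'; apply/eqP => /cpair_inj[[/ord_inj ->]].
  by rewrite hE => /esym.
- by rewrite foldl_cat; case: output.
Qed.

Lemma simulationE q t i :
  (iter t (sim_step (code_word q)) (sim_init i)).2 = observe M q t i.
Proof.
suff [] : represents i (iter t (sim_step (code_word q)) (sim_init i))
  (iter t (step (code_word q)) (init M)) by [].
elim: t => [|t IHt]; last by rewrite !iterS; exact: represents_step.
split => //= [j|j n]; rewrite ?/shead ?/stape entry0 //.
by rewrite /scode eqxx.
Qed.

Section Comp.
Context {T : Type} {cT : coded T}.

Lemma primrec_shead (Z : baire -> T -> nat) i :
  primrec Z -> primrec (fun p x => shead (Z p x) i).
Proof. by move=> cZ; rewrite /shead; primrec_auto_full. Qed.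

Lemma primrec_apply_move m (h : baire -> T -> nat) : primrec h ->
  primrec (fun p x => apply_move m (h p x)).
Proof. by case: m => ch; rewrite /apply_move; primrec_auto. Qed.

Lemma primrec_sim_step (a : baire -> T -> baire) (z : baire -> T -> sim_conf) :
  primrec (fun p (y : T * nat) => a p y.1 y.2) -> primrec z ->
  primrec (fun p x => sim_step (code_word (a p x)) (z p x)).
Proof.
move=> ca cz; apply: primrec_lookup => // [|[[s b] f]].
  rewrite /kcode; primrec_auto; first by apply: primrec_code_word; primrec_auto.
  elim: (enum _) => [|i l IHl] /=; first by primrec_auto.
  apply: primrec_cpair => //; rewrite /stape; primrec_auto_full.
  by apply: primrec_shead; primrec_auto.
move=> /=; set d := delta _ _ _; apply: primrec_pair; last first.
  by case: (output d) => [[]|]; rewrite /obs; primrec_auto.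
apply: primrec_pair; first by primrec_auto; apply: primrec_apply_move; primrec_auto.
apply: primrec_set_entries => [|i|i]; last 2 first.
- by primrec_auto.
- by apply: primrec_apply_move; apply: primrec_shead; primrec_auto.
apply: primrec_set_entries => [|i|i]; [by primrec_auto| |by primrec_auto].
by primrec_auto; apply: primrec_shead; primrec_auto.
Qed.

End Comp.

Lemma primrec_observe (T : Type) (cT : coded T)
    (a : baire -> T -> baire) (t i : baire -> T -> nat) :
  primrec (fun p (y : T * nat) => a p y.1 y.2) -> primrec t -> primrec i ->
  primrec (fun p x => observe M (a p x) (t p x) (i p x)).
Proof.
move=> ca ct ci.
have [e eE] : primrec (fun p x =>
    (iter (t p x) (sim_step (code_word (a p x))) (sim_init (i p x))).2).
  apply: primrec_snd; apply: primrec_iter => //; first by rewrite /sim_init; primrec_auto.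
  apply: (primrec_sim_step (a := fun p (y : T * sim_conf) => a p y.1)); last by primrec_auto.
  apply: (primrec_comp (g := fun p (y : T * nat) => a p y.1 y.2)
    (f := fun p (y : T * sim_conf * nat) => (y.1.1, y.2))) => //; primrec_auto.
by exists e => p x; rewrite eE simulationE.
Qed.

End Simulation.

Section Observation.
Variable M : machine.

Lemma obs_done c l : foldl obs (0, c) l = (0, c).
Proof. by elim: l => //= -[] l. Qed.

Lemma foldl_obs_number r v : foldl obs (r.+1, 0) (rcons (nseq v true) false) =
  (r, if r == 0 then v else 0).
Proof.
suff H m : foldl obs (r.+1, m) (rcons (nseq v true) false) =
    (r, if r == 0 then m + v else m).
  by rewrite H add0n; case: eqP.
elim: v m => [|v IHv] m /=; first by rewrite addn0; case: eqP.
by rewrite /obs /= -/obs eqSS; case: eqP IHv => // -> IHv; rewrite IHv addnS.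
Qed.

Lemma foldl_obs_code (s : baire) i n l :
  i < n -> foldl obs (i.+1, 0) (code s n ++ l) = (0, s i).
Proof.
move=> ltin; rewrite foldl_cat.
suff -> : foldl obs (i.+1, 0) (code s n) = (0, s i) by exact: obs_done.
have H j : j <= i -> foldl obs (i.+1, 0) (code s j) = (i.+1 - j, 0).
  elim: j => // j IHj ltji; rewrite codeS foldl_cat IHj; last by lia.
  have -> : i.+1 - j = (i - j).+1 by lia.
  by rewrite foldl_obs_number subSS; case: eqP => //; lia.
have /prefixP[l' ->] := prefix_code s ltin.
by rewrite codeS -catA foldl_cat H // subSnn foldl_cat foldl_obs_number obs_done.
Qed.

Lemma written_mono w t t' : t <= t' ->
  prefix (written (iter t (step w) (init M))) (written (iter t' (step w) (init M))).
Proof.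
move=> /subnK <-; elim: (t' - t) => [|d IHd]; first exact: prefix_refl.
by rewrite addSn iterS; apply: prefix_trans IHd (prefix_prefix _ _).
Qed.

Lemma observe_mono q t t' i c :
  t <= t' -> observe M q t i = (0, c) -> observe M q t' i = (0, c).
Proof.
rewrite /observe => /(written_mono (code_word q))/prefixP[l ->].
by rewrite foldl_cat => ->; exact: obs_done.
Qed.

Lemma produces_observe q s i :
  produces M q s -> exists t, observe M q t i = (0, s i).
Proof.
move=> /(_ i.+1)[t /prefixP[l E]]; exists t.
by rewrite /observe E foldl_obs_code.
Qed.

Lemma observe_produces q s t i c :
  produces M q s -> observe M q t i = (0, c) -> c = s i.
Proof.
move=> /(produces_observe i)[t' v'] v.
have := observe_mono (leq_maxl t t') v; rewrite (observe_mono (leq_maxr t t') v').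
by case.
Qed.

Lemma eq_code (q q' : baire) n :
  (forall i, i < n -> q i = q' i) -> code q n = code q' n.
Proof.
move=> E; rewrite /code; congr flatten.
by apply/eq_in_map => i; rewrite mem_iota => /E ->.
Qed.

(** A modulus of continuity: within [t] steps the input head gets no further than cell [t], and as
    each block of the code is nonempty, the bits up to there depend on the entries up to [t]
    only. *)
Lemma eq_observe (q q' : baire) t i :
  (forall j, j <= t -> q j = q' j) -> observe M q t i = observe M q' t i.
Proof.
move=> E; rewrite /observe.
have H n : n <= t ->
    iter n (step (code_word q)) (init M) = iter n (step (code_word q')) (init M) /\
    input_head (iter n (step (code_word q')) (init M)) <= n.
  elim: n => // n IHn ltn.
  have [e] := IHn (ltnW ltn); rewrite !iterS e; move: (iter n _ _) => c h; split.
    rewrite /step.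
    suff -> : code_word q (input_head c) = code_word q' (input_head c) by [].
    rewrite /code_word; congr nth; apply: eq_code => j; rewrite ltnS => lej.
    exact: E (leq_trans lej (leq_trans h (ltnW ltn))).
  by rewrite /step /=; set a := delta _ _ _; case: (input_move a) => /=; lia.
by rewrite (H t (leqnn t)).1.
Qed.

End Observation.

(** * Jumps of products and of sequence spaces *)

(** The coordinates are discrete, so convergence in the product means that each of them is
    eventually constant. *)
Lemma lim_baireP r q : lim_baire r q <->
  forall k, exists N, forall n, N <= n -> r (cpair n k) = q k.
Proof.
split=> [rq k|rq].
  have : nbhs q (proj k @^-1` [set q k]).
    by apply: proj_continuous; exact: discrete_set1.
  by move=> /rq [N _ NH]; exists N => n /NH.
apply/cvg_sup => k U [V [[W oW <-] Wq] VU].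
have [N NH] := rq k; exists N => // n /NH E; apply: VU.
by rewrite /= /proj /row E.
Qed.

Lemma rcomputable_total (X Y : rspace) (f : X -> Y) (A : baire -> baire) :
  primrec (fun p (n : nat) => A p n) ->
  (forall p x, rep X p x -> rep Y (A p) (f x)) -> rcomputable f.
Proof.
move=> cA Af; exists (Defs.total A); first exact: total_primrec.
by move=> p x px; exists (A p) => //; exact: Af.
Qed.

(** Turns a sequence of pairs into a pair of sequences; [zip_rows] is the inverse. *)
Definition unzip_rows (r : baire) : baire := fun m =>
  let y := cunpair m./2 in r (cpair y.1 (y.2.*2 + odd m)).

Definition zip_rows (r : baire) : baire := fun m =>
  let y := cunpair m in r ((cpair y.1 y.2./2).*2 + odd y.2).

Lemma jump_prod_iso (X Y : rspace) :
  @computable_iso (jump (prod_space X Y)) (prod_space (jump X) (jump Y)) id.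
Proof.
split; last (exists id; split => //).
- apply: (@rcomputable_total _ _ _ unzip_rows).
    by rewrite /unzip_rows; primrec_auto_full.
  move=> r [x y] [q /lim_baireP rq [/= qx qy]]; split => /=.
    exists (bleft q) => //; apply/lim_baireP => k.
    have [N NH] := rq k.*2; exists N => n /NH E.
    by rewrite /bleft -E /unzip_rows odd_double doubleK cpairK addn0.
  exists (bright q) => //; apply/lim_baireP => k.
  have [N NH] := rq k.*2.+1; exists N => n /NH E.
  by rewrite /bright -E /unzip_rows /= odd_double uphalf_double cpairK addn1.
- apply: (@rcomputable_total _ _ _ zip_rows).
    by rewrite /zip_rows; primrec_auto_full.
  move=> r [x y] [[p /lim_baireP rp px] [q /lim_baireP rq qy]].
  exists (bpair p q); last by rewrite /= bpairKl bpairKr.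
  apply/lim_baireP => k; rewrite /zip_rows /bpair.
  have [N NH] : exists N, forall n, N <= n ->
      r ((cpair n k./2).*2 + odd k) = if odd k then q k./2 else p k./2.
    case: (odd k); [have [N NH] := rq k./2|have [N NH] := rp k./2];
      by exists N => n /NH <-; rewrite ?addn1 ?addn0.
  by exists N => n /NH <-; rewrite cpairK.
Qed.

(** Exchanges the two outer indices of a double sequence. As an involution it realizes both
    directions of the isomorphism. *)
Definition swap_rows (r : baire) : baire := fun m =>
  let y := cunpair m in let z := cunpair y.2 in r (cpair z.1 (cpair y.1 z.2)).

Lemma swap_rowsE r i n k : swap_rows r (cpair i (cpair n k)) = r (cpair n (cpair i k)).
Proof. by rewrite /swap_rows !cpairK. Qed.

Lemma jump_seq_iso (X : rspace) :
  @computable_iso (jump (seq_space X)) (seq_space (jump X)) id.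
Proof.
have cs : primrec (fun p (n : nat) => swap_rows p n).
  by rewrite /swap_rows; primrec_auto_full.
split; last (exists id; split => //); apply: rcomputable_total cs _.
- move=> r s [q /lim_baireP rq qs] i; exists (row q i) => //; apply/lim_baireP => k.
  by have [N NH] := rq (cpair i k); exists N => n /NH E; rewrite /row -E swap_rowsE.
- move=> r s rs.
  have /choice[ps psE] i : exists p, lim_baire (row r i) p /\ rep X p (s i).
    by have [p] := rs i; exists p.
  have [q qE] := rows_surj ps; exists q; last by move=> i; rewrite qE; case: (psE i).
  apply/lim_baireP => m; rewrite -(cunpairK m); case: (cunpair m) => i k /=.
  have [/lim_baireP/(_ k)[N NH] _] := psE i; exists N => n /NH E.
  by rewrite swap_rowsE -/(row r i _) E -qE.
Qed.

(** Row n is what [M] has written after n steps on the input [a n], with 0 for an entry that is not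
    yet complete. *)
Definition approx (M : machine) (a : nat -> baire) : baire := fun m =>
  let y := cunpair m in let o := observe M (a y.1) y.1 y.2 in
  if o.1 == 0 then o.2 else 0.

(** Entry [k] of the output on [q] is complete after finitely many steps, which read finitely many
    entries of [q]. Eventually [a n] agrees with [q] there, and further steps do not alter the
    entry. *)
Lemma approx_lim M (a : nat -> baire) (q s : baire) :
  (forall k, exists N, forall n, N <= n -> a n k = q k) ->
  produces M q s -> lim_baire (approx M a) s.
Proof.
move=> aq qs; apply/lim_baireP => k.
have [t tE] := produces_observe k qs.
have [N NH] : exists N, forall n, N <= n -> forall j, j <= t -> a n j = q j.
  elim: t {tE} => [|t [N NH]].
    by have [N NH] := aq 0; exists N => n /NH E [|].
  have [N' NH'] := aq t.+1; exists (maxn N N') => n.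
  rewrite geq_max => /andP[/NH E /NH' E'] j.
  by rewrite leq_eqVlt => /orP[/eqP ->|/E].
exists (maxn N t) => n; rewrite geq_max => /andP[/NH E let_n].
rewrite /approx cpairK /=; have -> // : observe M (a n) n k = (0, s k).
by apply: observe_mono let_n _; rewrite (eq_observe _ _ E).
Qed.

Lemma primrec_approx M (T : Type) (cT : coded T) (a : baire -> T -> nat -> baire)
    (i : baire -> T -> nat) :
  primrec (fun p (y : T * nat * nat) => a p y.1.1 y.1.2 y.2) -> primrec i ->
  primrec (fun p x => approx M (a p x) (i p x)).
Proof.
move=> ca ci.
have cv : primrec (fun p x => observe M (a p x (cunpair (i p x)).1) (cunpair (i p x)).1
    (cunpair (i p x)).2).
  apply: (@primrec_observe M T _ (fun p x => a p x (cunpair (i p x)).1)); primrec_auto_full.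
  apply: (primrec_comp (g := fun p (y : T * nat * nat) => a p y.1.1 y.1.2 y.2)
    (f := fun p (y : T * nat) => (y.1, (cunpair (i p y.1)).1, y.2))) => //; primrec_auto_full.
  by apply: (primrec_comp (g := i)); primrec_auto_full.
by rewrite /approx /=; primrec_auto_full.
Qed.

(** * Jumps of function spaces *)

Definition join_rows (w : baire) (n : nat) : baire :=
  fun j => w ((cpair n j./2).*2 + odd j).

Lemma join_rowsE r r' n : join_rows (bpair r r') n = bpair (row r n) (row r' n).
Proof.
apply/funext => j; rewrite /join_rows /bpair /row.
by case: (odd j); rewrite ?addn1 ?addn0 /= odd_double /= ?uphalf_double ?doubleK.
Qed.

Lemma lim_join r r' p p' : lim_baire r p -> lim_baire r' p' ->
  forall j, exists N, forall n, N <= n -> join_rows (bpair r r') n j = bpair p p' j.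
Proof.
move=> /lim_baireP rp /lim_baireP rp' j.
have [N NH] : exists N, forall n, N <= n ->
    bpair (row r n) (row r' n) j = bpair p p' j.
  rewrite /bpair; case: (odd j); [have [N NH] := rp' j./2|have [N NH] := rp j./2];
    by exists N => n /NH.
by exists N => n; rewrite join_rowsE => /NH.
Qed.

Lemma jump_realizer (P : standard_rep) : exists2 S : baire -> baire,
  pcomputable (Defs.total S) &
  forall (X Y : rspace) (f : X -> Y) r p, lim_baire r p -> realizes (P p) f ->
    @realizes (jump X) (jump Y) (P (S r)) f.
Proof.
have [M MP] := Phi_utm P.
pose G w := approx M (join_rows w).
have [|S cS SG] := @Phi_smn P (Defs.total G).
  apply: total_primrec; rewrite /G.
  apply: (@primrec_approx M nat _ (fun p _ => join_rows p)); last exact: primrec_id.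
  by rewrite /join_rows; primrec_auto_full.
exists S => // X Y f r p rp Pf r' x [p' rp' px].
have [q Pq qy] := Pf _ _ px; exists (G (bpair r r')); first exact: SG.
exists q => //; apply: approx_lim (lim_join rp rp') _; apply: MP => /=.
by rewrite bpairKl bpairKr.
Qed.

(** * Bounded search, conditions and the limit of a chain of conditions *)

Definition exists_below (n : nat) (f : nat -> bool) : bool :=
  nat_rect (fun=> bool) false (fun z b => if b then true else f z) n.

Lemma exists_belowP n (f : nat -> bool) :
  exists_below n f <-> exists2 z, z < n & f z.
Proof.
elim: n => [|n IHn] /=; first by split => // -[].
split=> [|[z ltz fz]].
  by case: ifP => [/IHn[z ltz fz] _|_ fn]; [exists z => //; exact: ltnW|exists n].
case: ifP => // nf; move: ltz; rewrite ltnS leq_eqVlt => /orP[/eqP <- //|ltz].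
by move: nf => /negP; case; apply/IHn; exists z.
Qed.

Lemma primrec_exists_below (T : Type) (cT : coded T)
    (n : baire -> T -> nat) (f : baire -> T -> nat -> bool) :
  primrec n -> primrec (fun p (y : T * nat) => f p y.1 y.2) ->
  primrec (fun p x => exists_below (n p x) (f p x)).
Proof.
move=> cn cf; rewrite /exists_below.
apply: (primrec_rec (s := fun p x z b => if b then true else f p x z)); primrec_auto_full.
by apply: (primrec_comp (g := fun p (y : T * nat) => f p y.1 y.2)
  (f := fun p (y : T * (nat * bool)) => (y.1, y.2.1))); primrec_auto_full.
Qed.

(* A condition [(m, (l, w))] constrains a sequence of sequences [u] that shall
   converge to [p]: the first [l] entries of [u] are those of [entry w], and the
   further entries of the first [m] columns are those of [p]. *)
Definition cond := (nat * (nat * nat))%type.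

Definition ext (p : nat -> nat) (c : cond) (e : nat -> nat) : baire := fun j =>
  if j < c.2.1 then entry c.2.2 j
  else if (cunpair j).2 < c.1 then p (cunpair j).2 else e j.

(** Since [ext p c] overwrites a sequence by what [c] prescribes, the sequences satisfying [c] are
    its fixed points. *)
Definition respects p c (u : baire) := forall j, u j = ext p c u j.

(** Both bounds grow strictly, so that an infinite chain decides every entry and freezes every
    column. *)
Definition extends p (c c' : cond) :=
  [/\ c.1 < c'.1, c.2.1 < c'.2.1 & forall u, respects p c' u -> respects p c u].

Definition mkcond m l (u : nat -> nat) : cond := (m, (l, encode l u)).

Lemma ext_idem p c e : respects p c (ext p c e).
Proof. by move=> j; rewrite /ext; case: ifP => //; case: ifP. Qed.

Lemma mkcond_eq p m l (u u' : baire) j :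
  respects p (mkcond m l u) u' -> j < l -> u' j = u j.
Proof. by move=> /(_ j) -> ltj; rewrite /ext /= ltj entry_encode ltj. Qed.

(** Below [l] a sequence satisfying the new condition copies [u], which satisfies [c]; from [l] on,
    the columns frozen by [c] are still frozen. *)
Lemma mkcond_extends p (c : cond) m l u : respects p c u -> c.1 < m -> c.2.1 < l ->
  extends p c (mkcond m l u).
Proof.
move=> cu ltm ltl; split => // u' cu' j; have [ltj|lej] := ltnP j l.
  rewrite (mkcond_eq cu' ltj) cu /ext; case: ifP => // _; case: ifP => // _.
  by rewrite (mkcond_eq cu' ltj).
rewrite /ext ltnNge (leq_trans (ltnW ltl) lej) /=; case: ifP => // ltjm.
by rewrite cu' /ext /= ltnNge lej /= (ltn_trans ltjm ltm).
Qed.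

Lemma extends_trans p (c : nat -> cond) i j : (forall i, extends p (c i) (c i.+1)) ->
  i <= j -> forall u, respects p (c j) u -> respects p (c i) u.
Proof.
move=> cc /subnK <-; elim: (j - i) => // d IHd u; rewrite addSn.
by have [_ _ cS] := cc (d + i) => /cS /IHd.
Qed.

Lemma leq_cpair n k : n <= cpair n k.
Proof.
rewrite /cpair; have : n + k <= ((n + k) * (n + k).+1)./2.
  by case: (n + k) => // s; rewrite tri_succ; lia.
by lia.
Qed.

Lemma chain_limit p (c : nat -> cond) : (forall i, extends p (c i) (c i.+1)) ->
  exists2 u, lim_baire u p & forall i, respects p (c i) u.
Proof.
move=> cc.
have cm i : i <= (c i).1.
  by elim: i => // i IHi; case: (cc i) => [+ _ _]; exact: leq_ltn_trans.
have cl i : i <= (c i).2.1.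
  by elim: i => // i IHi; case: (cc i) => [_ + _]; exact: leq_ltn_trans.
(* Entry [j] is taken from the condition [c j.+1], whose prefix is longer than [j]. *)
pose u : baire := fun j => entry (c j.+1).2.2 j.
have uE i j : j < i -> u j = ext p (c i) (fun=> 0) j.
  move=> ltji; have := extends_trans cc ltji (@ext_idem p (c i) (fun=> 0)) => /(_ j) ->.
  by rewrite {1}/ext (cl j.+1).
have cu i : respects p (c i) u.
  move=> j; pose i' := maxn i j.+1; have lej : j < i' by rewrite leq_maxr.
  have := extends_trans cc (leq_maxl i j.+1) (@ext_idem p (c i') (fun=> 0)) => /(_ j).
  by rewrite -(uE _ _ lej) => ->; rewrite {1}/ext -(uE _ _ lej).
(* In these rows, column [k] lies beyond the prefix of [c k.+1], because [n <= cpair n k], and this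
   condition freezes it. *)
exists u => //; apply/lim_baireP => k; exists (c k.+1).2.1 => n len.
rewrite (cu k.+1) /ext cpairK /= ltnNge (leq_trans len (leq_cpair _ _)) /=.
by rewrite (cm k.+1).
Qed.

Lemma half_leq_id j : j./2 <= j.
Proof. by rewrite leq_half_double -addnn leqW // leq_addr. Qed.

(* [((s, c), ((N, v), k))] asks whether [c], with the frozen columns given by
   [entry s], forces the entry [k] of the rows from [N] on to be [v]. *)
Definition query := ((nat * cond) * ((nat * nat) * nat))%type.

Definition query_code (y : query) : nat := cd y.

Definition query_decode (x : nat) : query :=
  let a := (cunpair x).1 in let b := (cunpair x).2 in
  let c := (cunpair a).2 in let d := (cunpair b).1 in
  (((cunpair a).1, ((cunpair c).1, cunpair (cunpair c).2)), (cunpair d, (cunpair b).2)).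

Lemma query_codeK y : query_decode (query_code y) = y.
Proof.
case: y => -[s [m [l w]]] [[N v] k].
have cd_pair (T U : Type) (cT : coded T) (cU : coded U) (a : T) (b : U) :
  cd (a, b) = cpair (cd a) (cd b) by [].
by rewrite /query_decode /query_code !cd_pair !cpairK.
Qed.

(** The oracle depends on [q] alone, so a query carries the part of [p] in use: its values at the
    columns frozen by [c]. *)
Lemma ext_encode p (c : cond) e : ext (entry (encode c.1 p)) c e = ext p c e.
Proof.
by apply/funext => j; rewrite /ext entry_encode; case: ifP => // _; case: ifP => // ->.
Qed.

(** * Forcing the entries of the limit, and deciding it in the limit *)

Section Forcing.
Variable M : machine.

(** A potential refutation [z] codes the free entries of the sequence, a running time and a row. *)
Definition probe (q : baire) (y : query) (z : nat) : nat * nat :=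
  observe M (bpair q (ext (entry y.1.1) y.1.2 (entry (cunpair z).1)))
    (cunpair (cunpair z).2).1 (cpair (cunpair (cunpair z).2).2 y.2.2).

Definition refutes (q : baire) (y : query) (z : nat) : bool :=
  (y.2.1.1 <= (cunpair (cunpair z).2).2) &&
  (((probe q y z).1 == 0) && ~~ ((probe q y z).2 == y.2.1.2)).

Lemma primrec_refutes (T : Type) (cT : coded T)
    (y : baire -> T -> query) (z : baire -> T -> nat) :
  primrec y -> primrec z -> primrec (fun p x => refutes p (y p x) (z p x)).
Proof.
move=> cy cz; have cp : primrec (fun p x => probe p (y p x) (z p x)).
  apply: (@primrec_observe M T _ (fun p x => bpair p (ext (entry (y p x).1.1) (y p x).1.2
    (entry (cunpair (z p x)).1)))); primrec_auto_full.
  rewrite /bpair /ext.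
  have cy' : primrec (fun p (u : T * nat) => y p u.1).
    by apply: (primrec_comp (g := y)); primrec_auto.
  have cz' : primrec (fun p (u : T * nat) => z p u.1).
    by apply: (primrec_comp (g := z)); primrec_auto.
  by primrec_auto_full.
by rewrite /refutes; primrec_auto_full.
Qed.

(** The n-th approximation of [oracle]: only the refutations below n are tried. *)
Definition guess (q : baire) (n : nat) : baire := fun x =>
  nat_of_bool (exists_below n (refutes q (query_decode x))).

(* The answer 0 means that the claim is forced. *)
Definition oracle (q : baire) : baire := fun x =>
  nat_of_bool `[< exists z, refutes q (query_decode x) z >].

Lemma primrec_guess (T : Type) (cT : coded T) (n x : baire -> T -> nat) :
  primrec n -> primrec x -> primrec (fun p y => guess p (n p y) (x p y)).
Proof.
move=> cn cx; apply: primrec_nat_of_bool; apply: primrec_exists_below => //.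
have cx' : primrec (fun p (u : T * nat) => x p u.1).
  by apply: (primrec_comp (g := x)); primrec_auto.
by apply: primrec_refutes; rewrite /query_decode; primrec_auto_full.
Qed.

(** A refutation is found from some stage on and stays found; if there is none, every stage answers
    0. *)
Lemma guess_oracle q x : exists N, forall n, N <= n -> guess q n x = oracle q x.
Proof.
rewrite /oracle; case: (asboolP (exists z, _)) => [[z fz]|nf] /=.
  exists z.+1 => n ltzn; rewrite /guess.
  have -> // : exists_below n (refutes q (query_decode x)).
  by apply/exists_belowP; exists z.
exists 0 => n _; rewrite /guess; case E: (exists_below _ _) => //; case: nf.
by move/exists_belowP: E => [z _ fz]; exists z.
Qed.

Section Fixed.
Variables (q p : baire).
Hypothesis converges : forall u, lim_baire u p ->
  exists s y, produces M (bpair q u) s /\ lim_baire s y.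

Definition query_of (c : cond) N v k : query := ((encode c.1 p, c), ((N, v), k)).

Definition forced c N v k := oracle q (query_code (query_of c N v k)) = 0.

Lemma forcedE c N v k :
  forced c N v k <-> forall z, ~~ refutes q (query_of c N v k) z.
Proof.
rewrite /forced /oracle query_codeK; case: asboolP => [[z fz]|nf] /=; split => //.
  by move=> /(_ z); rewrite fz.
by move=> _ z; apply/negP => fz; apply: nf; exists z.
Qed.

Lemma probeE c N v k e t n : probe q (query_of c N v k) (cpair e (cpair t n)) =
  observe M (bpair q (ext p c (entry e))) t (cpair n k).
Proof. by rewrite /probe !cpairK /= ext_encode. Qed.

Lemma forced_value c N v k u n t a : forced c N v k -> respects p c u -> N <= n ->
  observe M (bpair q u) t (cpair n k) = (0, a) -> a = v.
Proof.
(* The part of [u] that [t] steps can read, followed by zeros in the free places, would give a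
   refutation if [a] differed from [v]. *)
move=> /forcedE/(_ (cpair (encode t.+1 u) (cpair t n))) + cu leN va.
rewrite /refutes probeE !cpairK /= leN /=.
have -> : observe M (bpair q (ext p c (entry (encode t.+1 u)))) t (cpair n k) = (0, a).
  rewrite -va; apply: eq_observe => j lej; rewrite /bpair; case: (odd j) => //.
  by rewrite [u _]cu /ext entry_encode ltnS (leq_trans (half_leq_id j) lej).
by rewrite /= negbK => /eqP.
Qed.

Lemma not_forced c N v k : ~ forced c N v k -> exists u n t a,
    [/\ respects p c u, N <= n, observe M (bpair q u) t (cpair n k) = (0, a) & a != v].
Proof.
move=> /forcedE/existsNP[z /negP].
rewrite negbK -(cunpairK z) -(cunpairK (cunpair z).2).
move: (cunpair z).1 (cunpair (cunpair z).2) => e [t n].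
rewrite /refutes probeE !cpairK /= => /andP[leN /andP[/eqP v0 av]].
exists (ext p c (entry e)), n, t.
exists (observe M (bpair q (ext p c (entry e))) t (cpair n k)).2.
split => //; first exact: ext_idem.
by rewrite -v0 -surjective_pairing.
Qed.

(* Otherwise conditions can be extended for ever, each time with another value
   at the entry [k] of a later row; in the limit this contradicts [converges]. *)
Lemma exists_forced c k : exists u m l N v,
  [/\ respects p c u, c.1 < m, c.2.1 < l & forced (mkcond m l u) N v k].
Proof.
apply: contrapT => H.
have {}H u m l N v :
    respects p c u -> c.1 < m -> c.2.1 < l -> ~ forced (mkcond m l u) N v k.
  by move=> cu ltm ltl F; apply: H; exists u, m, l, N, v.
(* A state consists of a condition, the last value seen at the entry [k] and a lower bound for the
   next row. A good state has a condition of the form to which [H] applies. *)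
pose good (s : cond * nat * nat) := exists u, [/\ respects p c u, c.1 < s.1.1.1,
  c.2.1 < s.1.1.2.1 & s.1.1 = mkcond s.1.1.1 s.1.1.2.1 u].
pose next (s s' : cond * nat * nat) :=
  [/\ extends p s.1.1 s'.1.1, s'.1.2 != s.1.2, s.2 < s'.2 &
    exists n t, s.2 <= n /\ forall u, respects p s'.1.1 u ->
      observe M (bpair q u) t (cpair n k) = (0, s'.1.2)].
have /choice[F FP] s : exists s', good s -> good s' /\ next s s'.
  case: s => [[d v] N].
  have [[u [cu ltm ltl dE]]|] := pselect (good (d, v, N)); last by exists (d, v, N).
  rewrite /= in ltm ltl dE.
  have [u' [n [t [a [du' leN va av]]]]] := not_forced (H u _ _ N v cu ltm ltl).
  rewrite -dE in du'.
  have cu' : respects p c u'.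
    have [_ _] := mkcond_extends cu ltm ltl; rewrite -dE; exact.
  (* The prefix covers all that the [t] steps read, so every sequence satisfying the new condition
     shows the value [a] in row [n]; the next row will be larger. *)
  exists (mkcond d.1.+1 (maxn d.2.1 t).+1 u', a, n.+1) => _; split.
    by exists u'; split => //=; [exact: ltnW|rewrite ltnS leq_max ltnW].
  split => //=.
    by apply: mkcond_extends => //; rewrite ltnS leq_maxl.
  exists n, t; split => // u'' du''; rewrite -va; apply: eq_observe => j lej.
  rewrite /bpair; case: (odd j) => //; apply: mkcond_eq du'' _.
  by rewrite ltnS leq_max (leq_trans (half_leq_id j) lej) orbT.
pose s i := iter i F (mkcond c.1.+1 c.2.1.+1 (ext p c (fun=> 0)), 0, 0).
have sg i : good (s i).
  elim: i => [|i IHi]; last by have [] := FP _ IHi.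
  by exists (ext p c (fun=> 0)); split => //; exact: ext_idem.
have sn i : next (s i) (s i.+1) by have [] := FP _ (sg i).
have [u up cu] := @chain_limit p (fun i => (s i).1.1)
  (fun i => let: And4 e _ _ _ := sn i in e).
have [r [y [ur /lim_baireP ry]]] := converges up.
have sN i : i <= (s i).2.
  by elim: i => // i IHi; have [_ _ lt _] := sn i; exact: leq_ltn_trans lt.
have val i : exists2 n, i <= n & r (cpair n k) = (s i.+1).1.2.
  have [_ _ _ [n [t [leN va]]]] := sn i; exists n; first exact: leq_trans (sN i) leN.
  by rewrite (observe_produces ur (va _ (cu i.+1))).
(* Two consecutive values are shown in rows from [N] on. Both equal the limit [y k], although
   consecutive values differ. *)
have [N NH] := ry k; have [n len E] := val N; have [n' len' E'] := val N.+1.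
have [_ + _ _] := sn N.+1; rewrite -E -E' !NH ?eqxx //; exact: ltnW.
Qed.

End Fixed.
End Forcing.

(** * The search through conditions *)

Lemma primrec_query_code (T : Type) (cT : coded T) (y : baire -> T -> query) :
  primrec y -> primrec (fun p x => query_code (y p x)).
Proof. by move=> [e eE]; exists e. Qed.

(* A candidate [z] codes two increments, an extension and the pair [(N, v)]
   claiming that the value is [v] in all the rows from [N] on. *)
Definition candidate (p : nat -> nat) (c : cond) (z : nat) : cond :=
  mkcond (c.1 + (cunpair (cunpair z).1).1).+1 (c.2.1 + (cunpair (cunpair z).1).2).+1
    (ext p c (entry (cunpair (cunpair z).2).1)).

Definition claim (z : nat) : nat * nat := cunpair (cunpair (cunpair z).2).2.

(** The state [s] holds the entry being determined, the current condition and the candidate under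
    test. *)
Definition accepts (O p : baire) (s : nat * cond * nat) : bool :=
  O (query_code (query_of p (candidate p s.1.2 s.2)
       (claim s.2).1 (claim s.2).2 s.1.1)) == 0.

Definition search_step (w : baire) (s : nat * cond * nat) : nat * cond * nat :=
  if accepts (bleft w) (bright w) s then (s.1.1.+1, candidate (bright w) s.1.2 s.2, 0)
  else (s.1.1, s.1.2, s.2.+1).

Definition search_state w t := iter t (search_step w) (0, (0, (0, 0)), 0).

Lemma search_stateS w t : search_state w t.+1 = search_step w (search_state w t).
Proof. exact: iterS. Qed.

Definition search (w : baire) (t : nat) : nat :=
  if accepts (bleft w) (bright w) (search_state w t)
  then (claim (search_state w t).2).2.+1 else 0.

Section PrimrecSearch.
Context {T : Type} {cT : coded T}.

Lemma primrec_candidate (c : baire -> T -> cond) (z : baire -> T -> nat) :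
  primrec c -> primrec z -> primrec (fun w x => candidate (bright w) (c w x) (z w x)).
Proof.
move=> cc cz; rewrite /candidate /mkcond /bright; primrec_auto_full; rewrite /ext.
have cc' : primrec (fun p (u : T * nat) => c p u.1).
  by apply: (primrec_comp (g := c)); primrec_auto.
have cz' : primrec (fun p (u : T * nat) => z p u.1).
  by apply: (primrec_comp (g := z)); primrec_auto.
by primrec_auto_full.
Qed.

Lemma primrec_accepts (s : baire -> T -> nat * cond * nat) :
  primrec s -> primrec (fun w x => accepts (bleft w) (bright w) (s w x)).
Proof.
move=> cs; rewrite /accepts {1}/bleft /query_of /claim.
have cc : primrec (fun w x => candidate (bright w) (s w x).1.2 (s w x).2).
  by apply: primrec_candidate; primrec_auto_full.
apply: primrec_eq; last by primrec_auto.
apply: primrec_orc; apply: primrec_double; apply: primrec_query_code.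
apply: primrec_pair; last by primrec_auto_full.
apply: primrec_pair; last exact: cc.
apply: primrec_encode; first exact: primrec_fst.
by rewrite /bright; primrec_auto_full.
Qed.

Lemma primrec_search_step (s : baire -> T -> nat * cond * nat) :
  primrec s -> primrec (fun w x => search_step w (s w x)).
Proof.
move=> cs; apply: primrec_if; first exact: primrec_accepts.
  by primrec_auto_full; apply: primrec_candidate; primrec_auto_full.
by primrec_auto_full.
Qed.

End PrimrecSearch.

Lemma primrec_search : primrec search.
Proof.
have cs : primrec search_state.
  rewrite /search_state; primrec_auto_full.
  exact: (primrec_search_step (s := fun _ y => y.2)) (primrec_snd primrec_id).
rewrite /search /claim; apply: primrec_if; first exact: primrec_accepts.
- by primrec_auto_full.
- by primrec_auto_full.
Qed.

(** The search terminates for each entry by [exists_forced]. The accepted conditions form a chain;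
    its limit [u] satisfies them all, so the accepted values are those of the limit of the output on
    [u]. *)
Lemma search_emits M q p :
  (forall u, lim_baire u p -> exists s y, produces M (bpair q u) s /\ lim_baire s y) ->
  exists2 u, lim_baire u p & forall s y, produces M (bpair q u) s -> lim_baire s y ->
    emits search (bpair (oracle M q) p) y.
Proof.
move=> conv; pose O := oracle M q; pose w := bpair O p.
have /choice[zf zfP] (kc : nat * cond) : exists z, accepts O p (kc, z) /\
    forall z', z' < z -> ~~ accepts O p (kc, z').
  have ex : exists z, accepts O p (kc, z).
    have [u [m [l [N [v [cu ltm ltl F]]]]]] := exists_forced conv kc.2 kc.1.
    (* The subtracted successors are those added in [candidate], where they make every candidate a
       strict extension. *)
    exists (cpair (cpair (m - kc.2.1.+1) (l - kc.2.2.1.+1))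
      (cpair (encode l u) (cpair N v))).
    rewrite /accepts /claim /candidate /= !cpairK /=; move: F; rewrite /forced => F.
    have -> : (kc.2.1 + (m - kc.2.1.+1)).+1 = m by lia.
    have -> : (kc.2.2.1 + (l - kc.2.2.1.+1)).+1 = l by lia.
    suff -> : mkcond m l (ext p kc.2 (entry (encode l u))) = mkcond m l u.
      exact/eqP.
    congr (_, (_, _)); apply: eq_encode => j ltj.
    by rewrite [u _]cu /ext entry_encode ltj.
  case: (ex_minnP ex) => z az zmin; exists z; split => // z' lt.
  by apply/negP => /zmin; rewrite leqNgt lt.
pose c k := nat_rect (fun=> cond) (0, (0, 0))
  (fun k ck => candidate p ck (zf (k, ck))) k.
pose v k := (claim (zf (k, c k))).2.
have run k : exists t,
    search_state w t = (k, c k, 0) /\ emitted search w t = mkseq v k.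
  elim: k => [|k [t [st et]]]; first by exists 0.
  have [az zmin] := zfP (k, c k).
  have wait j : j <= zf (k, c k) -> search_state w (j + t) = (k, c k, j) /\
      emitted search w (j + t) = mkseq v k.
    elim: j => // j IHj ltj; have [sj ej] := IHj (ltnW ltj).
    rewrite addSn emittedS ej search_stateS /search /search_step sj.
    rewrite /w bpairKl bpairKr (negPf (zmin _ ltj)).
    by rewrite cats0.
  have [sz ez] := wait _ (leqnn _); exists (zf (k, c k) + t).+1.
  rewrite emittedS ez search_stateS /search /search_step sz.
  rewrite /w bpairKl bpairKr az; split; first by [].
  by rewrite /mkseq -[k.+1]addn1 iotaD map_cat.
have cc k : extends p (c k) (c k.+1).
  by apply: mkcond_extends; [exact: ext_idem|rewrite ltnS leq_addr..].
have [u up cu] := chain_limit cc; exists u => // s y us /lim_baireP sy n.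
have [t [_ et]] := run n; exists t; rewrite et.
suff -> : mkseq y n = mkseq v n by exact: prefix_refl.
apply/eq_mkseq => k; have [N NH] := sy k.
have [/eqP az _] := zfP (k, c k).
(* A row past both thresholds: there the entry equals its limit and also the claimed value. *)
pose n' := maxn N (claim (zf (k, c k))).1.
rewrite -(NH n') ?leq_maxl //; have [t' tE] := produces_observe (cpair n' k) us.
exact: forced_value az (cu k.+1) (leq_maxr _ _) tE.
Qed.

(** By smn, an index for [search] is computable from the oracle, which is itself only a limit.
    Running the machine [MS] on the stages [guess M q] gives a sequence converging to that index. *)
Lemma unjump_realizer (P : standard_rep) : exists2 S : baire -> baire,
  pcomputable (Defs.total S) &
  forall (X Y : rspace) (f : X -> Y) q, @realizes (jump X) (jump Y) (P q) f ->
    exists2 p, lim_baire (S q) p & realizes (P p) f.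
Proof.
have [M MP] := Phi_utm P.
have [S [MS MSP] SE] := Phi_smn P (emits_primrec primrec_search).
exists (fun q => approx MS (guess M q)).
  apply: total_primrec; apply: (@primrec_approx MS nat _ (fun p _ => guess M p)).
    by apply: primrec_guess; primrec_auto.
  exact: primrec_id.
move=> X Y f q Pq; exists (S (oracle M q)).
  by apply: approx_lim (MSP _ _ _) => // k; exact: guess_oracle.
move=> p x px.
have real u : lim_baire u p -> exists s y,
    [/\ P q u s, produces M (bpair q u) s, lim_baire s y & rep Y y (f x)].
  move=> up; have [|s Pqs [y sy yf]] := Pq u x; first by exists p.
  by exists s, y; split => //; apply: MP; rewrite /= bpairKl bpairKr.
have [|u up uE] := @search_emits M q p.
  by move=> u /real[s [y [_ us sy _]]]; exists s, y.
have [s [y [_ us sy yf]]] := real u up; exists y => //.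
by apply: SE; exact: uE us sy.
Qed.

Theorem theorem4p12 (P : standard_rep) (X Y : rspace) :
  [/\ @computable_iso (jump (prod_space X Y)) (prod_space (jump X) (jump Y)) id,
      @computable_iso (jump (seq_space X)) (seq_space (jump X)) id,
      exists h : jump (cont_space P X Y) -> cont_space P (jump X) (jump Y),
        (forall f, sval (h f) = sval f) /\ computable_iso h &
      [set f : X -> Y | @rcontinuous (jump X) (jump Y) f] =
      [set f : X -> Y | @rcontinuous X Y f]].
Proof.
have [S1 cS1 S1P] := jump_realizer P; have [S2 cS2 S2P] := unjump_realizer P.
(* A continuous [f] has a name in the jump of the function space; [S1] maps it to an index of a
   continuous realizer on the jumps. *)
have cj (f : X -> Y) : rcontinuous f -> @rcontinuous (jump X) (jump Y) f.
  move=> cf; have [r [p rp Pf]] := @rep_surj (jump (cont_space P X Y)) (exist _ f cf).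
  by exists (P (S1 r)); [case: (Phi_cont P (S1 r))|exact: S1P rp Pf].
have uj (f : X -> Y) : @rcontinuous (jump X) (jump Y) f -> rcontinuous f.
  move=> cf; have [q Pq] := @rep_surj (cont_space P (jump X) (jump Y)) (exist _ f cf).
  have [p _ Pf] := S2P _ _ _ _ Pq.
  by exists (P p) => //; case: (Phi_cont P p).
split; [exact: jump_prod_iso|exact: jump_seq_iso| |by apply/seteqP; split].
(* Only the proof of continuity changes, the underlying function is kept. *)
exists (fun f : {f : X -> Y | rcontinuous f} => exist _ (sval f) (cj _ (svalP f))).
split => //; split.
  exists (Defs.total S1) => // r [f cf] [p rp Pf].
  by exists (S1 r) => //; exact: S1P rp Pf.
exists (fun f : {f : X -> Y | @rcontinuous (jump X) (jump Y) f} =>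
  exist _ (sval f) (uj _ (svalP f))); split.
- by move=> [f cf]; exact: eq_exist.
- by move=> [f cf]; exact: eq_exist.
exists (Defs.total S2) => // q [f cf] Pq.
by have [p Sp Pf] := S2P _ _ _ _ Pq; exists (S2 q) => //; exists p.
Qed.
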